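(* Consider the problem, the Lagrangian $\mathcal L$ and the NPGA iteration described in the context. Assume: (1) $\mathcal{L}$ has at least one saddle point; (2) the network graph is undirected and connected; (3) for every $i$, $f_i$ is $\mu_i$-strongly convex and $l_i$-smooth with $l_i\ge\mu_i>0$, and $g_i$ and $h$ are proper, convex and lower semicontinuous; put $\mu=\min_i\mu_i$, $l=\max_i l_i$; (4) the symmetric matrices $B,C,D\in\mathbb{R}^{n\times n}$ satisfy: $C=0$ or $\mathrm{Null}(C)=\mathrm{Span}(\mathbf 1_n)$; $\mathrm{Null}(B)=\mathrm{Span}(\mathbf 1_n)$; $0\le C<I$ and $B^2\le I$; $D$ is symmetric doubly stochastic; (5) $g_i=0$ for all $i$ and $A=[A_1,\dots,A_n]$ has full row rank; (6) $\mathrm{Null}(C)=\mathrm{Span}(\mathbf 1_n)$; (7) $D^2\le I-B^2$. Let $\mathbf y^0=0$, $\theta\ge 0$, and let the positive step-sizes $\alpha,\beta,\gamma$ satisfy $$\alpha<\frac{1}{l(1+2\theta)},\qquad \beta\le\frac{\mu}{\overline\sigma^2(\mathbf A)\left(\frac{1}{1-\overline\sigma(C)}+\theta\right)},\qquad \gamma<1.$$ Let $E=\mathbf A\mathbf A^\top+\frac{1}{2\alpha\beta}\mathbf C$. Then $$\delta=\max\left\{1-\alpha\mu\big(1-\alpha l(1+2\theta)\big),\ 1-\alpha\beta\,\underline\eta(E),\ 1-\gamma\underline\sigma^2(B)\right\}$$ lies in $(0,1)$, and the NPGA iterates satisfy $\|\mathbf x^k-\mathbf x^*\|^2=\mathcal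 O(\delta^k)$.
   Context: Problem: $n$ agents solve $\min_{x_i\in\mathbb R^{d_i}}\sum_{i=1}^n (f_i(x_i)+g_i(x_i))+h\left(\sum_{i=1}^n A_ix_i\right)$, where $f_i:\mathbb R^{d_i}\to\mathbb R$, $g_i:\mathbb R^{d_i}\to\mathbb R\cup\{+\infty\}$, $h:\mathbb R^p\to\mathbb R\cup\{+\infty\}$, $A_i\in\mathbb R^{p\times d_i}$; the solution set is assumed nonempty. Let $d=\sum_i d_i$, $\mathbf x=[x_1^\top,\dots,x_n^\top]^\top\in\mathbb R^d$, $f(\mathbf x)=\sum_i f_i(x_i)$, $g(\mathbf x)=\sum_i g_i(x_i)$, $A=[A_1,\dots,A_n]\in\mathbb R^{p\times d}$, $\mathbf A=\mathrm{diag}(A_1,\dots,A_n)\in\mathbb R^{np\times d}$ (block diagonal). $h^*$ is the Fenchel conjugate of $h$. The Lagrangian is $\mathcal L(\mathbf x,\lambda)=f(\mathbf x)+g(\mathbf x)+\lambda^\top A\mathbf x-h^*(\lambda)$ for $\lambda\in\mathbb R^p$ (min over $\mathbf x$, max over $\lambda$). ''$l_i$-smooth'' means differentiable with $l_i$-Lipschitz gradient. Notation: for symmetric matrices, $M\le N$ ($M<N$) means $N-M$ is positive semidefinite (positive definite). $\overline\sigma(\cdot)$ and $\underline\sigma(\cdot)$ are the largest and the smallest non-zero singular values; $\underline\eta(\cdot)$ is the smallest non-zero eigenvalue. $\mathbf 1_n$ is the all-ones vector. $\mathrm{prox}_{\alpha \phi}(x)=\arg\min_y \phi(y)+\frac1{2\alpha}\|y-x\|^2$.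 The network is a graph on the agents $\{1,\dots,n\}$; $B,C,D\in\mathbb R^{n\times n}$ are symmetric matrices associated with it, $\mathbf B=B\otimes I_p$, $\mathbf C=C\otimes I_p$, $\mathbf D=D\otimes I_p$. For $\boldsymbol\lambda=[\lambda_1^\top,\dots,\lambda_n^\top]^\top\in\mathbb R^{np}$ put $\mathbf h(\boldsymbol\lambda)=\frac1n\sum_{i=1}^n h^*(\lambda_i)$. NPGA: given parameters $\alpha,\beta,\gamma>0$, $\theta\ge0$ and initial points $\mathbf x^0\in\mathbb R^d$, $\boldsymbol\lambda^0\in\mathbb R^{np}$ (arbitrary) and $\mathbf y^0\in\mathbb R^{np}$, for $k\ge0$: $\mathbf x^{k+1}=\mathrm{prox}_{\alpha g}(\mathbf x^k-\alpha(\nabla f(\mathbf x^k)+\mathbf A^\top\boldsymbol\lambda^k))$, $\hat{\mathbf x}^{k+1}=\mathbf x^{k+1}+\theta(\mathbf x^{k+1}-\mathbf x^k)$, $\mathbf v^{k+1}=\boldsymbol\lambda^k-\mathbf C\boldsymbol\lambda^k-\mathbf B\mathbf y^k+\beta\mathbf A\hat{\mathbf x}^{k+1}$, $\mathbf y^{k+1}=\mathbf y^k+\gamma\mathbf B\mathbf v^{k+1}$, $\boldsymbol\lambda^{k+1}=\mathrm{prox}_{\beta\mathbf h}(\mathbf D\mathbf v^{k+1})$. $\mathbf x^*$ denotes the (unique) solution of the problem, i.e. the $\mathbf x$-component of the saddle point of $\mathcal L$. *)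

(* Defs.v *)
From HB Require Import structures.
From mathcomp Require Import all_boot all_order all_algebra.
From mathcomp Require Import all_classical all_reals all_analysis.

Set Implicit Arguments.
Unset Strict Implicit.
Unset Printing Implicit Defensive.

Import Order.TTheory GRing.Theory Num.Theory.
Import numFieldNormedType.Exports.

Local Open Scope classical_set_scope.
Local Open Scope ring_scope.

Section Euclidean.
Context {R : realType} {m : nat}.
Implicit Types (u v : 'cV[R]_m) (M N : 'M[R]_m).

Definition dotp u v : R := (u^T *m v) 0 0.

(* The library norm on matrices is the sup norm, hence the explicit
   Euclidean norm. *)
Definition sqnorm u : R := dotp u u.
Definition enorm u : R := Num.sqrt (sqnorm u).

Definition psdmx M := forall v, 0 <= dotp v (M *m v).
Definition pdmx M := forall v, v != 0 -> 0 < dotp v (M *m v).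
Definition loewner_le M N := psdmx (N - M).
Definition loewner_lt M N := pdmx (N - M).

Definition null_space M : set 'cV[R]_m := [set v | M *m v = 0].
Definition span_ones : set 'cV[R]_m := [set v | exists a : R, v = const_mx a].

Definition doubly_stochastic M :=
  [/\ forall i j, 0 <= M i j,
      forall i, \sum_j M i j = 1
    & forall j, \sum_i M i j = 1].

End Euclidean.

(* For M with more columns than rows, [singular_values M] may contain a spurious
   0, which affects neither the largest nor the smallest nonzero one.  The sets
   below are finite, so sup and inf are a maximum and a minimum as soon as the
   set is nonempty. *)
Definition singular_values {R : realType} {m q} (M : 'M[R]_(m, q)) : set R :=
  [set s | 0 <= s /\ eigenvalue (M^T *m M) (s ^+ 2)].
Definition sv_max {R : realType} {m q} (M : 'M[R]_(m, q)) : R :=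
  sup (singular_values M).
Definition sv_min_nz {R : realType} {m q} (M : 'M[R]_(m, q)) : R :=
  inf [set s | singular_values M s /\ s != 0].
Definition eig_min_nz {R : realType} {m} (M : 'M[R]_m) : R :=
  inf [set a | eigenvalue M a /\ a != 0].

(* Minimum and maximum of a finite family; junk value 0 when n = 0. *)
Definition fmin {R : realType} {n} (F : 'I_n -> R) : R := inf (range F).
Definition fmax {R : realType} {n} (F : 'I_n -> R) : R := sup (range F).

Section ConvexAnalysis.
Context {R : realType} {m : nat}.
Implicit Types (phi : 'cV[R]_m -> \bar R) (f : 'cV[R]_m -> R).

Definition strongly_convex (mu : R) f :=
  forall (x y : 'cV[R]_m) (t : R), 0 <= t <= 1 ->
    f (t *: x + (1 - t) *: y) <=
      t * f x + (1 - t) * f y - mu / 2 * t * (1 - t) * sqnorm (x - y).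

Definition grad f (x : 'cV[R]_m) : 'cV[R]_m :=
  \col_j 'D_(delta_mx j 0) f x.

Definition smooth (l : R) f :=
  (forall x, differentiable f x) /\
  (forall x y, enorm (grad f x - grad f y) <= l * enorm (x - y)).

Definition proper phi :=
  (forall x, (-oo < phi x)%E) /\ (exists x, (phi x < +oo)%E).

Definition econvex phi :=
  forall (x y : 'cV[R]_m) (t : R), 0 < t < 1 ->
    (phi (t *: x + (1 - t) *: y)%R <= t%:E * phi x + (1 - t)%:E * phi y)%E.

Definition proper_convex_lsc phi :=
  [/\ proper phi, econvex phi & lower_semicontinuous phi].

Definition fenchel phi (s : 'cV[R]_m) : \bar R :=
  ereal_sup (range (fun y : 'cV[R]_m => (dotp s y)%:E - phi y)%E).

Definition argmin phi : set 'cV[R]_m :=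
  [set z | forall y, (phi z <= phi y)%E].

Definition prox (alpha : R) phi (x : 'cV[R]_m) : set 'cV[R]_m :=
  argmin (fun y => phi y + ((2 * alpha)^-1 * sqnorm (y - x))%:E)%E.

End ConvexAnalysis.

Definition saddle_point {R : realType} {U V : Type} (L : U -> V -> \bar R)
    (x : U) (lam : V) :=
  (forall lam', (L x lam' <= L x lam)%E) /\
  (forall x', (L x lam <= L x' lam)%E).

Definition connected_undirected {n} (e : rel 'I_n) :=
  symmetric e /\ forall i j, connect e i j.

Section NPGA.
Context {R : realType} {n p : nat} {d : 'I_n -> nat}.
Variables (f : forall i, 'cV[R]_(d i) -> R)
  (g : forall i, 'cV[R]_(d i) -> \bar R) (h : 'cV[R]_p -> \bar R)
  (A : forall i, 'M[R]_(p, d i)).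

Definition fsum (x : 'cV[R]_(\sum_(i < n) d i)) : R :=
  \sum_(i < n) f (submxcol x i).

Definition gsum (x : 'cV[R]_(\sum_(i < n) d i)) : \bar R :=
  (\sum_(i < n) g (submxcol x i))%E.

Definition Arow : 'M[R]_(p, \sum_(i < n) d i) := \mxrow_(i < n) A i.

(* diag(A_1, ..., A_n), whose blocks need not be square. *)
Definition Adiag : 'M[R]_(\sum_(i < n) p, \sum_(i < n) d i) :=
  \mxblock_(i < n, j < n) ((i == j)%:R *: A j).

(* The Kronecker product of M and I_p, by blocks. *)
Definition kronI (M : 'M[R]_n) : 'M[R]_(\sum_(i < n) p) :=
  \mxblock_(i < n, j < n) ((M i j)%:M : 'M[R]_p).

Definition objective (x : 'cV[R]_(\sum_(i < n) d i)) : \bar R :=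
  ((\sum_(i < n) ((f (submxcol x i))%:E + g (submxcol x i)))
   + h (\sum_(i < n) A i *m submxcol x i)%R)%E.

Definition lagrangian (x : 'cV[R]_(\sum_(i < n) d i)) (lam : 'cV[R]_p) :
    \bar R :=
  ((fsum x)%:E + gsum x + (dotp lam (Arow *m x))%:E - fenchel h lam)%E.

Definition havg (lam : 'cV[R]_(\sum_(i < n) p)) : \bar R :=
  ((n%:R^-1)%:E * \sum_(i < n) fenchel h (submxcol lam i))%E.

(* The proximal points are characterised as minimizers, so that the predicate
   holds of every sequence produced by the recursion. *)
Definition npga (B C D : 'M[R]_n) (alpha beta gamma theta : R)
    (x : nat -> 'cV[R]_(\sum_(i < n) d i))
    (y lam : nat -> 'cV[R]_(\sum_(i < n) p)) :=
  forall k,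
    let xhat := x k.+1 + theta *: (x k.+1 - x k) in
    let v := lam k - kronI C *m lam k - kronI B *m y k
             + beta *: (Adiag *m xhat) in
    [/\ prox alpha gsum
          (x k - alpha *: (grad fsum (x k) + Adiag^T *m lam k)) (x k.+1),
        y k.+1 = y k + gamma *: (kronI B *m v)
      & prox beta havg (kronI D *m v) (lam k.+1)].

End NPGA.

(* Main.v *)
(* Let x, y, lam be the errors of the iterates with respect to a fixed point,
   G the corresponding difference of gradients, K = 1 / (1 - sv_max C) and
   kappa = K + theta.  The function
     V = (beta / alpha) |x|^2 - kappa beta^2 |A x|^2 + |lam|^2 + |y|^2 / gamma
   contracts by the factor delta at each step:
   - the prox is nonexpansive and D^2 <= I - B^2, so completing a square gives
     |lam+|^2 + |y+|^2 / gamma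
       <= |w|^2 - |B y|^2 + |y|^2 / gamma - (1 - gamma) |B v|^2
     with w = (I - C) lam + beta A xhat, and |B y|^2 >= sv_min_nz(B)^2 |y|^2
     because y stays in the range of B;
   - 0 <= C <= sv_max(C) I bounds |w|^2, leaving -|lam|_C^2 / 2 to spare;
   - an exact identity for the gradient step trades 2 beta <lam, A xhat> for
     the decrease of |x|^2, a term -alpha beta |A^T lam|^2, which together with
     -|lam|_C^2 / 2 is -alpha beta <lam, E lam>, and a term controlled by the
     cocoercivity and the strong monotonicity of the gradient.
   Subtracting kappa beta^2 |A x|^2 in V is what absorbs the term |A x+|^2.

   No spectral theorem is needed: the infimum of a Rayleigh quotient is an
   eigenvalue, since otherwise S - aI, being positive semidefinite and
   invertible, would be bounded below.  The multiplier comes directly from the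
   optimality of the primal solution, so neither biconjugation nor the existence
   of proximal points plays a role. *)

Require Import Defs.
From HB Require Import structures.
From mathcomp Require Import all_boot all_order all_algebra.
From mathcomp Require Import all_classical all_reals all_analysis.
From mathcomp Require Import ring lra.

Set Implicit Arguments.
Unset Strict Implicit.
Unset Printing Implicit Defensive.

Import Order.TTheory GRing.Theory Num.Theory.
Import numFieldNormedType.Exports.

Local Open Scope classical_set_scope.
Local Open Scope ring_scope.


(** * Euclidean inner product and Cauchy-Schwarz inequalities *)

Section DotProduct.
Context {R : realType} {m : nat}.
Implicit Types (u v w : 'cV[R]_m) (P S : 'M[R]_m).

Lemma dotpE u v : dotp u v = \sum_i u i 0 * v i 0.
Proof. by rewrite /dotp mxE; apply: eq_bigr => i _; rewrite mxE. Qed.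

Lemma dotpC u v : dotp u v = dotp v u.
Proof. by rewrite !dotpE; apply: eq_bigr => i _; rewrite mulrC. Qed.

Lemma dotpDr u v w : dotp u (v + w) = dotp u v + dotp u w.
Proof. by rewrite /dotp mulmxDr mxE. Qed.

Lemma dotpDl u v w : dotp (v + w) u = dotp v u + dotp w u.
Proof. by rewrite dotpC dotpDr !(dotpC u). Qed.

Lemma dotpZr a u v : dotp u (a *: v) = a * dotp u v.
Proof. by rewrite /dotp -scalemxAr mxE. Qed.

Lemma dotpZl a u v : dotp (a *: v) u = a * dotp v u.
Proof. by rewrite dotpC dotpZr dotpC. Qed.

Lemma dotpNr u v : dotp u (- v) = - dotp u v.
Proof. by rewrite -scaleN1r dotpZr mulN1r. Qed.

Lemma dotpNl u v : dotp (- v) u = - dotp v u.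
Proof. by rewrite dotpC dotpNr dotpC. Qed.

Lemma dotp0r u : dotp u 0 = 0.
Proof. by rewrite /dotp mulmx0 mxE. Qed.

Lemma dotp0l u : dotp 0 u = 0.
Proof. by rewrite dotpC dotp0r. Qed.

Definition dotp_lin := (dotpDr, dotpDl, dotpZr, dotpZl, dotpNr, dotpNl).

Lemma sqnormE u : sqnorm u = dotp u u. Proof. by []. Qed.

Lemma sqnorm_ge0 u : 0 <= sqnorm u.
Proof. by rewrite /sqnorm dotpE sumr_ge0 // => i _; rewrite -expr2 sqr_ge0. Qed.

Lemma sqnorm_le0 u : sqnorm u <= 0 -> u = 0.
Proof.
rewrite /sqnorm dotpE => u0; apply/matrixP => i j; rewrite ord1 mxE.
have : \sum_i u i 0 * u i 0 == 0.
  by rewrite eq_le u0 sumr_ge0 // => k _; rewrite -expr2 sqr_ge0.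
rewrite psumr_eq0 => [/allP/(_ i)|k _]; last by rewrite -expr2 sqr_ge0.
by rewrite mem_index_enum => /(_ isT)/=; rewrite -expr2 sqrf_eq0 => /eqP.
Qed.

Lemma sqnorm_gt0 u : u != 0 -> 0 < sqnorm u.
Proof. by rewrite ltNge; apply: contraNN => /sqnorm_le0 ->. Qed.

Lemma sqnormZ a u : sqnorm (a *: u) = a ^+ 2 * sqnorm u.
Proof. by rewrite /sqnorm !dotp_lin mulrA. Qed.

Lemma sqnormD u v : sqnorm (u + v) = sqnorm u + 2 * dotp u v + sqnorm v.
Proof. by rewrite /sqnorm !dotp_lin (dotpC v u); ring. Qed.

Lemma enorm_sqr u : enorm u ^+ 2 = sqnorm u.
Proof. by rewrite sqr_sqrtr // sqnorm_ge0. Qed.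

(** The form at [s *: u + t *: v] is a nonnegative quadratic in [s] and [t]; taking
    [(s, t) = (c, - a)] gives c (b c - a^2) >= 0. Since [P] may be singular, [c = 0] is treated
    apart, with [(a, - b)] or [(1, - a)]. *)
Lemma psd_cauchy_schwarz P u v : P^T = P -> psdmx P ->
  dotp u (P *m v) ^+ 2 <= dotp u (P *m u) * dotp v (P *m v).
Proof.
move=> symP P0.
have symd (a b : 'cV[R]_m) : dotp a (P *m b) = dotp b (P *m a).
  by rewrite dotpC /dotp trmx_mul symP mulmxA.
set a := dotp u _; set b := dotp u _; set c := dotp v _.
have quad (s t : R) : 0 <= s ^+ 2 * b + 2 * s * t * a + t ^+ 2 * c.
  have := P0 (s *: u + t *: v).
  rewrite !mulmxDr -!scalemxAr !dotp_lin (symd v u) -/a -/b -/c => H.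
  by apply: le_trans H _; rewrite le_eqVlt; apply/orP; left; apply/eqP; ring.
have b0 : 0 <= b := P0 u; have c0 : 0 <= c := P0 v.
have [cz|cn0] := eqVneq c 0.
  have [bz|bn0] := eqVneq b 0; last first.
    rewrite cz mulr0; have bp : 0 < b by rewrite lt_neqAle eq_sym bn0.
    rewrite -(pmulr_rle0 _ bp); have := quad a (- b); rewrite cz; lra.
  rewrite cz mulr0; have := quad 1 (- a); rewrite bz cz; lra.
have := quad c (- a); have : 0 < c by rewrite lt_neqAle eq_sym cn0.
move=> cp H; have : 0 <= c * (b * c - a ^+ 2).
  by apply: le_trans H _; rewrite le_eqVlt; apply/orP; left; apply/eqP; ring.
by rewrite pmulr_rge0 // subr_ge0.
Qed.

Lemma cauchy_schwarz u v : dotp u v ^+ 2 <= sqnorm u * sqnorm v.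
Proof.
have := @psd_cauchy_schwarz 1%:M u v (trmx1 _ _); rewrite !mul1mx; apply.
by move=> w; rewrite mul1mx; exact: sqnorm_ge0.
Qed.

Lemma dotp_le_enorm u v : dotp u v <= enorm u * enorm v.
Proof.
apply: le_trans (ler_norm _) _; rewrite -sqrtr_sqr /enorm -sqrtrM ?sqnorm_ge0//.
by rewrite ler_wsqrtr// cauchy_schwarz.
Qed.

End DotProduct.

Lemma dotp_trmx {R : realType} {m q : nat} (M : 'M[R]_(m, q)) u v :
  dotp u (M *m v) = dotp (M^T *m u) v.
Proof. by rewrite /dotp trmx_mul trmxK mulmxA. Qed.

(** * Extreme Rayleigh quotients as eigenvalues *)

Section Rayleigh.
Context {R : realType} {m : nat}.
Implicit Types (u v w : 'cV[R]_m) (P S : 'M[R]_m).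

(** That is, P <= c I implies P^2 <= c P: Cauchy-Schwarz for the form of [P], applied to [v] and
    [P *m v], bounds |P v|^4 by <v, P v> c |P v|^2. *)
Lemma psd_sqnorm_le P c v : P^T = P -> psdmx P -> 
  (forall w, dotp w (P *m w) <= c * sqnorm w) ->
  sqnorm (P *m v) <= c * dotp v (P *m v).
Proof.
move=> symP P0 Pc; have [->|Pv0] := eqVneq (P *m v) 0.
  by rewrite /sqnorm !dotp0r mulr0.
have := psd_cauchy_schwarz v (P *m v) symP P0.
rewrite (dotp_trmx P v) symP -sqnormE.
have := Pc (P *m v); have := sqnorm_gt0 Pv0; have := P0 v.
set a := dotp v _; set s := sqnorm _; set b := dotp _ _ => a0 s0 bs H.
have : s * s <= s * (c * a).
  by rewrite -expr2; apply: le_trans H _; rewrite mulrC [leRHS]mulrA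
    [s * c]mulrC ler_wpM2r.
by rewrite ler_pM2l.
Qed.

Lemma quadratic_form_bounded S :
  exists2 c, 0 <= c & forall v, `|dotp v (S *m v)| <= c * sqnorm v.
Proof.
exists (\sum_i \sum_j `|S i j|).
  by rewrite sumr_ge0 // => i _; rewrite sumr_ge0.
move=> v; have vi i : `|v i 0| ^+ 2 <= sqnorm v.
  rewrite /sqnorm dotpE (bigD1 i)//= real_normK ?num_real// expr2 lerDl.
  by rewrite sumr_ge0 // => k _; rewrite -expr2 sqr_ge0.
rewrite dotpE mulr_suml; apply: le_trans (ler_norm_sum _ _ _) _.
apply: ler_sum => i _; rewrite mxE mulr_sumr mulr_suml.
apply: le_trans (ler_norm_sum _ _ _) _; apply: ler_sum => j _.
rewrite !normrM mulrCA ler_wpM2l//.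
have := vi i; have := vi j; set a := `|_|; set b := `|_|; nra.
Qed.

(** Eigenvectors in the library are row vectors; symmetry lets transposition turn them into
    columns. *)
Lemma eigenvalue_symP S a : S^T = S ->
  reflect (exists2 v : 'cV_m, S *m v = a *: v & v != 0) (eigenvalue S a).
Proof.
move=> symS; apply: (iffP eigenvalueP) => -[v Sv v0]; exists v^T.
- by rewrite -{1}symS -trmx_mul Sv linearZ.
- by rewrite trmx_eq0.
- by rewrite -{1}symS -trmx_mul Sv linearZ.
- by rewrite trmx_eq0.
Qed.

Lemma rayleigh_min S : (0 < m)%N -> S^T = S ->
  exists2 a, eigenvalue S a & forall v, a * sqnorm v <= dotp v (S *m v).
Proof.
move=> m0 symS; have [c c0 Sc] := quadratic_form_bounded S.
pose X := [set dotp v (S *m v) | v in [set v | sqnorm v = 1]].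
have X0 : X !=set0.
  exists (dotp (delta_mx (Ordinal m0) 0 : 'cV_m) (S *m delta_mx (Ordinal m0) 0)).
  exists (delta_mx (Ordinal m0) 0) => //=.
  rewrite sqnormE dotpE (bigD1 (Ordinal m0))//= !mxE !eqxx mulr1 big1 ?addr0//.
  by move=> i /negPf ni; rewrite mxE ni mul0r.
have Xlb : has_lbound X.
  exists (- c) => _ [v /= v1 <-]; have := Sc v; rewrite v1 mulr1 ler_norml.
  by case/andP.
pose P := S - (inf X)%:M.
have PE v : dotp v (P *m v) = dotp v (S *m v) - inf X * sqnorm v.
  by rewrite mulmxBl mul_scalar_mx !dotp_lin.
have unit_lb b : (forall v, sqnorm v = 1 -> b <= dotp v (S *m v)) ->
    forall v, b * sqnorm v <= dotp v (S *m v).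
  move=> Hb v; have [->|v0] := eqVneq v 0.
    by rewrite sqnormE mulmx0 !dotp0r mulr0.
  have vp := sqnorm_gt0 v0; pose t := (Num.sqrt (sqnorm v))^-1.
  have t2 : t ^+ 2 = (sqnorm v)^-1 by rewrite exprVn sqr_sqrtr // ltW.
  have := Hb (t *: v); rewrite sqnormZ t2 mulVf ?gt_eqF// => /(_ erefl).
  by rewrite -scalemxAr dotpZl dotpZr mulrA -expr2 t2 mulrC ler_pdivlMr.
have infS v : inf X * sqnorm v <= dotp v (S *m v).
  by apply: unit_lb => u u1; apply: ge_inf => //; exists u.
have P0 : psdmx P by move=> v; rewrite PE subr_ge0.
have symP : P^T = P by rewrite linearB /= symS tr_scalar_mx.
exists (inf X) => //.
rewrite /eigenvalue /eigenspace kermx_eq0 row_free_unit -/P.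
apply/negP => Pu; have [cP cP0 Pc] := quadratic_form_bounded P.
have [cQ cQ0 Qc] := quadratic_form_bounded ((invmx P)^T *m invmx P).
(* With [P] invertible, |v|^2 <= cQ |P v|^2 <= cQ cP <v, P v>, so [inf X] could be raised by 1 / (cQ
   cP + 1). The summand 1 keeps this increment positive even if cQ cP = 0. *)
have key v : sqnorm v <= (cQ * cP + 1) * dotp v (P *m v).
  have := Qc (P *m v); rewrite -mulmxA mulKmx// dotp_trmx trmxK mulKmx//.
  rewrite -sqnormE ger0_norm ?sqnorm_ge0// => H.
  apply: le_trans H _; have := psd_sqnorm_le v symP P0.
  move=> /(_ cP (fun w => le_trans (ler_norm _) (Pc w))) H.
  have := P0 v; have := ler_wpM2l cQ0 H; rewrite mulrA; lra.
have k0 : 0 < cQ * cP + 1 by rewrite ltr_wpDl // mulr_ge0.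
have : inf X + (cQ * cP + 1)^-1 <= inf X.
  apply: lb_le_inf => // _ [v /= v1 <-]; have := key v.
  rewrite v1 PE v1 mulr1 -ler_pdivrMl// mulr1; lra.
by rewrite gerDl leNgt invr_gt0 k0.
Qed.

Lemma rayleigh_max S : (0 < m)%N -> S^T = S ->
  exists2 a, eigenvalue S a & forall v, dotp v (S *m v) <= a * sqnorm v.
Proof.
move=> m0 symS; have symNS : (- S)^T = - S by rewrite linearN /= symS.
have [a /(eigenvalue_symP _ symNS)[v Sv v0] aS] := rayleigh_min m0 symNS.
exists (- a) => [|w].
  apply/eigenvalue_symP => //; exists v => //.
  by rewrite scaleNr -Sv mulNmx opprK.
by have := aS w; rewrite mulNmx dotpNr mulNr; lra.
Qed.

End Rayleigh.

(** * Extreme singular values and eigenvalues as bounds on quadratic forms *)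

Section SingularValues.
Context {R : realType}.

Lemma gram_sym {m q} (M : 'M[R]_(m, q)) : (M^T *m M)^T = M^T *m M.
Proof. by rewrite trmx_mul trmxK. Qed.

Lemma dotp_gram {m q} (M : 'M[R]_(m, q)) v :
  dotp v (M^T *m M *m v) = sqnorm (M *m v).
Proof. by rewrite -mulmxA dotp_trmx trmxK. Qed.

(** The Rayleigh maximum [a] of the Gram matrix is an eigenvalue, so [Num.sqrt a] is both a singular
    value and an upper bound of them. *)
Lemma sv_max_attained {m q} (M : 'M[R]_(m, q)) : (0 < q)%N ->
  [/\ 0 <= sv_max M,
      forall v, sqnorm (M *m v) <= sv_max M ^+ 2 * sqnorm v
    & exists2 v, v != 0 & sqnorm (M *m v) = sv_max M ^+ 2 * sqnorm v].
Proof.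
move=> q0; have [a ea Ma] := rayleigh_max q0 (gram_sym M).
have /(eigenvalue_symP _ (gram_sym M))[v Mv v0] := ea.
have Mva : sqnorm (M *m v) = a * sqnorm v by rewrite -dotp_gram Mv dotpZr.
have a0 : 0 <= a.
  by rewrite -(pmulr_lge0 _ (sqnorm_gt0 v0)) -Mva sqnorm_ge0.
have sa : singular_values M (Num.sqrt a).
  by split; [exact: sqrtr_ge0|rewrite sqr_sqrtr].
have ub : ubound (singular_values M) (Num.sqrt a).
  move=> s [s0 /(eigenvalue_symP _ (gram_sym M))[w Mw w0]].
  rewrite -(ger0_norm s0) -sqrtr_sqr ler_wsqrtr//.
  by have := Ma w; rewrite Mw dotpZr ler_pM2r// sqnorm_gt0.
have -> : sv_max M = Num.sqrt a.
  apply/eqP; rewrite eq_le; apply/andP; split.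
    by apply: ge_sup => //; exists (Num.sqrt a).
  by apply: ub_le_sup => //; exists (Num.sqrt a).
rewrite sqr_sqrtr//; split; [exact: sqrtr_ge0|by move=> w; rewrite -dotp_gram|].
by exists v.
Qed.

Lemma sv_max_le {m q} (M : 'M[R]_(m, q)) v :
  sqnorm (M *m v) <= sv_max M ^+ 2 * sqnorm v.
Proof.
have [q0|/(sv_max_attained M)[]//] := posnP q.
have -> : v = 0 by apply/matrixP => -[k kq]; exfalso; move: kq; rewrite q0.
by rewrite mulmx0 /sqnorm !dotp0r mulr0.
Qed.

Lemma psd_sv_max {m} (C : 'M[R]_m) : (0 < m)%N -> C^T = C -> psdmx C ->
  loewner_lt C 1%:M ->
  [/\ 0 <= sv_max C < 1,
      forall v, dotp v (C *m v) <= sv_max C * sqnorm v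
    & forall v, sqnorm (C *m v) <= sv_max C * dotp v (C *m v)].
Proof.
move=> m0 symC C0 C1; have [s0 Cs [v v0 Cv]] := sv_max_attained C m0.
have C1le w : dotp w (C *m w) <= 1 * sqnorm w.
  have [->|w0] := eqVneq w 0; first by rewrite /sqnorm mulmx0 !dotp0r mulr0.
  by have := C1 _ w0; rewrite mulmxBl mul1mx !dotp_lin /sqnorm mul1r; lra.
have Cle w : dotp w (C *m w) <= sv_max C * sqnorm w.
  apply: le_trans (dotp_le_enorm _ _) _.
  rewrite -(enorm_sqr w) expr2 mulrCA ler_wpM2l ?sqrtr_ge0//.
  rewrite -(ger0_norm s0) -sqrtr_sqr /enorm -sqrtrM ?sqr_ge0//.
  by rewrite ler_wsqrtr.
split => // [|w]; last exact: psd_sqnorm_le.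
(* At a [v] attaining [sv_max C], C <= I gives |C v|^2 <= <v, C v>, and C < I gives <v, C v> <
   |v|^2; hence the square of [sv_max C] is below 1. *)
rewrite s0 /=; have := psd_sqnorm_le v symC C0 C1le; rewrite Cv mul1r => H.
have := C1 _ v0; rewrite mulmxBl mul1mx !dotp_lin -sqnormE => Cvv.
rewrite -(expr_lt1 (n := 2))//; have := sqnorm_gt0 v0 => v00.
by rewrite -(ltr_pM2r v00) mul1r; lra.
Qed.

(** Definiteness excludes the eigenvalue 0, so the smallest nonzero eigenvalue is the Rayleigh
    minimum. *)
Lemma eig_min_nz_pd {m} (S : 'M[R]_m) : (0 < m)%N -> S^T = S -> pdmx S ->
  0 < eig_min_nz S /\ forall v, eig_min_nz S * sqnorm v <= dotp v (S *m v).
Proof.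
move=> m0 symS S0; have [a ea aS] := rayleigh_min m0 symS.
have pos b : eigenvalue S b -> 0 < b.
  move=> /(eigenvalue_symP _ symS)[v Sv v0].
  by have := S0 _ v0; rewrite Sv dotpZr pmulr_lgt0// sqnorm_gt0.
have lb : lbound [set b | eigenvalue S b /\ b != 0] a.
  move=> b [/(eigenvalue_symP _ symS)[v Sv v0] _].
  by have := aS v; rewrite Sv dotpZr ler_pM2r// sqnorm_gt0.
suff -> : eig_min_nz S = a by split => //; exact: pos.
have aX : [set b | eigenvalue S b /\ b != 0] a.
  by split => //; rewrite gt_eqF// pos.
apply/eqP; rewrite eq_le; apply/andP; split.
  by apply: ge_inf => //; exists a.
by apply: lb_le_inf => //; exists a.
Qed.

End SingularValues.


(** The limit t -> 0+ along t = 1 / (N + 2), a choice that keeps t strictly inside (0, 1) as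
    convexity inequalities require. It discards second-order remainders. *)
Lemma ge0_of_small_slope {R : realType} (a b : R) :
  (forall N : nat, 0 <= a + N.+2%:R^-1 * b) -> 0 <= a.
Proof.
move=> H; rewrite leNgt; apply/negP => a0.
pose N := Num.truncn (`|b| / - a).
have : `|b| / - a < N.+2%:R.
  apply: lt_trans (truncnS_gt _) _; by rewrite ltr_nat.
rewrite ltr_pdivrMr ?oppr_gt0// => bN; have := H N.
rewrite -(pmulr_lge0 _ (ltr0Sn R N.+1)) mulrDl mulrAC mulVf ?mul1r ?pnatr_eq0//.
by have := ler_norm b; lra.
Qed.

(** * Gradient inequalities for smooth and strongly convex functions *)

Section SmoothConvex.
Context {R : realType} {m : nat}.
Implicit Types (f : 'cV[R]_m -> R) (x y v : 'cV[R]_m).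

Lemma dotp_grad f x v : differentiable f x -> dotp (grad f x) v = 'D_v f x.
Proof.
move=> df; rewrite deriveE// dotpE.
rewrite [in RHS](matrix_sum_delta v) linear_sum; apply: eq_bigr => i _ /=.
by rewrite big_ord1 linearZ /= mxE -deriveE// mulrC.
Qed.

(** The right difference quotient along [v] is at most c + t b, and t b falls below any [e > 0] as t
    decreases to 0. *)
Lemma dotp_grad_le f x v c b : differentiable f x ->
  (forall t, 0 < t < 1 -> f (x + t *: v) <= f x + t * c + t ^+ 2 * b) ->
  dotp (grad f x) v <= c.
Proof.
move=> df H; rewrite dotp_grad//.
have /cvg_dnbhs_at_right dv := diff_derivable (v := v) df.
apply/ler_addgt0Pr => e e0.
rewrite /derive -(cvg_lim (@norm_hausdorff _ _) dv).
apply: limr_le; first exact: cvgP dv.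
near=> t.
have t0 : 0 < t by near: t; exact: nbhs_right_gt.
have t1 : t < 1 by near: t; exact: nbhs_right_lt.
have te : t < e / (`|b| + 1).
  by near: t; apply: nbhs_right_lt; rewrite divr_gt0// ltr_wpDl.
rewrite /= [_ *: _]mulrC ler_pdivrMr// [t *: v + x]addrC.
have := H t; rewrite t0 t1 => /(_ isT).
move: te; rewrite ltr_pdivlMr ?ltr_wpDl// => te.
move=> Ht; have tb : t * b < e.
  by have := ler_wpM2l (ltW t0) (ler_norm b); lra.
have : t * (t * b) <= t * e by rewrite ler_wpM2l ?ltW.
rewrite mulrA -expr2; lra.
Unshelve. all: by end_near. Qed.

(** In the definition of strong convexity, the factor t (1 - t) splits into a slope and a t^2
    remainder; [dotp_grad_le] drops the remainder. *)
Lemma strongly_convex_ge mu f x y : differentiable f x ->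
  strongly_convex mu f ->
  f x + dotp (grad f x) (y - x) + mu / 2 * sqnorm (y - x) <= f y.
Proof.
move=> df sc; rewrite addrAC -lerBrDl.
apply: (@dotp_grad_le _ _ _ _ (mu / 2 * sqnorm (y - x))) => // t /andP[t0 t1].
have := sc y x t; rewrite (ltW t0) (ltW t1) => /(_ isT).
rewrite (_ : t *: y + (1 - t) *: x = x + t *: (y - x)).
  by move=> H; apply: le_trans H _; lra.
by apply/matrixP => i j; rewrite !mxE; ring.
Qed.

Lemma strongly_convex_monotone mu f x y : differentiable f x ->
  differentiable f y -> strongly_convex mu f ->
  mu * sqnorm (x - y) <= dotp (x - y) (grad f x - grad f y).
Proof.
move=> dfx dfy sc; have := strongly_convex_ge x dfy sc.
have := strongly_convex_ge y dfx sc; rewrite -(opprB x y) /sqnorm !dotp_lin.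
rewrite !(dotpC (grad f _)); lra.
Qed.

Lemma strongly_convexW mu nu f : nu <= mu ->
  strongly_convex mu f -> strongly_convex nu f.
Proof.
move=> numu sc x y t t01; apply: le_trans (sc x y t t01) _.
rewrite lerD2l lerN2 ler_wpM2r ?sqnorm_ge0//.
by have /andP[t0 t1] := t01; rewrite !ler_wpM2r ?subr_ge0//.
Qed.

(* Summing the gradient inequality along N equal steps from x to y is a
   Riemann sum of the usual integral proof, with error l |y - x|^2 / (2 N). *)
Lemma smooth_le l f x y : strongly_convex 0 f -> smooth l f ->
  f y <= f x + dotp (grad f x) (y - x) + l / 2 * sqnorm (y - x).
Proof.
move=> sc [df lip]; set v := y - x.
rewrite -subr_ge0; apply: (@ge0_of_small_slope _ _ (l / 2 * sqnorm v)) => N.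
set h : R := N.+2%:R^-1.
have h0 : 0 < h by rewrite invr_gt0 ltr0n.
(* Convexity is used at the far end of each step, where the gradient has moved by at most l (j + 1)
   h |v|; summing these errors gives the factor j (j + 1) / 2. *)
have step (j : nat) : f (x + (j%:R * h) *: v) <= f x
    + j%:R * h * dotp (grad f x) v
    + l * h ^+ 2 / 2 * (j%:R * (j%:R + 1)) * sqnorm v.
  elim: j => [|j IH]; first by rewrite !mul0r scale0r !addr0 mulr0 mul0r addr0.
  set z := x + (j.+1%:R * h) *: v.
  have xj : x + (j%:R * h) *: v = z - h *: v.
    by apply/matrixP => a b; rewrite !mxE -natr1; ring.
  rewrite xj in IH.
  have := strongly_convex_ge (z - h *: v) (df z) sc.
  rewrite mul0r mul0r addr0 addrAC subrr add0r dotpNr dotpZr => Hz.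
  have : dotp (grad f z - grad f x) v <= l * (j.+1%:R * h) * sqnorm v.
    apply: le_trans (dotp_le_enorm _ _) _.
    have -> : sqnorm v = enorm v * enorm v by rewrite -expr2 enorm_sqr.
    rewrite mulrA ler_wpM2r ?sqrtr_ge0//; apply: le_trans (lip _ _) _.
    rewrite /z addrAC subrr add0r /enorm sqnormZ sqrtrM ?sqr_ge0// sqrtr_sqr.
    by rewrite ger0_norm ?mulrA// mulr_ge0// ltW.
  rewrite dotpDl dotpNl => Hd; have := ler_wpM2l (ltW h0) Hd.
  rewrite -natr1; move: IH Hz; rewrite -/z.
  lra.
have hN : N.+2%:R * h = 1 by rewrite divff ?pnatr_eq0.
have := step N.+2; rewrite hN mul1r scale1r.
rewrite (_ : x + v = y); last by rewrite /v addrC subrK.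
have -> : l * h ^+ 2 / 2 * (N.+2%:R * (N.+2%:R + 1)) =
   l / 2 * (N.+2%:R * h) * (N.+2%:R * h + h) by ring.
rewrite hN; lra.
Qed.

(** At z = b - g / l, the minimizer of the gap between the quadratic upper bound from [b] and the
    affine lower bound from [a], these bounds give [half]. Adding [half] to its copy with the points
    exchanged cancels the function values. *)
Lemma smooth_cocoercive l f x y : 0 < l -> strongly_convex 0 f -> smooth l f ->
  sqnorm (grad f x - grad f y) <= l * dotp (x - y) (grad f x - grad f y).
Proof.
move=> l0 sc sm.
have half a b : f a + dotp (grad f a) (b - a)
    + (2 * l)^-1 * sqnorm (grad f b - grad f a) <= f b.
  move gE : (grad f b - grad f a) => g; pose z := b - l^-1 *: g.
  have := strongly_convex_ge z (sm.1 a) sc; have := smooth_le b z sc sm.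
  have -> : z - b = - (l^-1 *: g) by rewrite /z addrAC subrr add0r.
  have -> : z - a = (b - a) - l^-1 *: g by rewrite /z addrAC.
  rewrite /sqnorm !dotp_lin !mul0r addr0 !mulrN opprK.
  have -> : dotp g g = dotp (grad f b) g - dotp (grad f a) g.
    by rewrite -{1}gE dotpDl dotpNl.
  rewrite invfM; have : l * l^-1 = 1 by rewrite divff ?gt_eqF.
  set p := dotp _ g; set q := dotp _ g; set k := l^-1 => lk.
  have -> : l / 2 * (k * (k * (p - q))) = (l * k) * k / 2 * (p - q) by ring.
  rewrite lk; lra.
have := half x y; have := half y x; rewrite -(opprB x y) -(opprB (grad f x)).
rewrite {1 2}/sqnorm !dotpNl !dotpNr opprK invfM => H1 H2.
rewrite [dotp (x - y) _]dotpC dotpDl dotpNl -ler_pdivrMl//.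
by move: H1 H2; rewrite -sqnormE; lra.
Qed.

End SmoothConvex.


(** * Block vectors, separable sums and block matrices *)

Section Blocks.
Context {R : realType} {n : nat} {q : 'I_n -> nat}.
Implicit Types (u v : 'cV[R]_(\sum_(i < n) q i)).

Lemma dotp_blocks u v :
  dotp u v = \sum_i dotp (submxcol u i) (submxcol v i).
Proof.
rewrite -[u in LHS]submxcolK -[v in LHS]submxcolK /dotp tr_mxcol.
by rewrite mul_mxrow_mxcol summxE.
Qed.

Lemma submxcolZ a u i : submxcol (a *: u) i = a *: submxcol u i.
Proof. by apply/matrixP => j k; rewrite !mxE. Qed.

Lemma sqnorm_blocks u : sqnorm u = \sum_i sqnorm (submxcol u i).
Proof. exact: dotp_blocks. Qed.

(** A coordinate direction perturbs a single block, so the difference quotients already coincide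
    before the limit is taken. *)
Lemma submxcol_grad_fsum (f : forall i, 'cV[R]_(q i) -> R) u i :
  submxcol (grad (fsum f) u) i = grad (f i) (submxcol u i).
Proof.
apply/matrixP => j k; rewrite ord1 !mxE /derive.
suff -> : (fun t : R => t^-1 *: ((fsum f \o shift u)
      (t *: delta_mx (tagnat.Rank i j) 0) - fsum f u)) =
    (fun t : R => t^-1 *: ((f i \o shift (submxcol u i))
      (t *: delta_mx j 0) - f i (submxcol u i))) by [].
apply/funext => t /=; congr (_ *: _).
rewrite /fsum (bigD1 i)//= [X in _ - X](bigD1 i)//= opprD addrACA -[RHS]addr0.
congr (_ + _).
  congr (f i _ - _); apply/matrixP => a b; rewrite !mxE !ord1.
  by rewrite (inj_eq (@tagnat.rank_inj _ _)) eq_Tagged.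
apply/eqP; rewrite subr_eq0; apply/eqP; apply: eq_bigr => r ri.
congr (f r _); apply/matrixP => a b; rewrite !mxE !ord1 andbT.
case: eqP => [/(congr1 (@tagnat.sig1 _ _))|_]; last by rewrite mulr0 add0r.
by rewrite !tagnat.Rank1K => /eqP; rewrite (negPf ri).
Qed.

Lemma submxcol_Adiag {p} (A : forall i, 'M[R]_(p, q i)) u i :
  submxcol (Adiag A *m u) i = A i *m submxcol u i.
Proof.
rewrite -[u in LHS]submxcolK /Adiag mxblockEv mxcol_mul mxcolK mul_mxrow_mxcol.
rewrite (bigD1 i)//= eqxx scale1r big1 ?addr0// => j ji.
by rewrite eq_sym (negPf ji) scale0r mul0mx.
Qed.

Lemma submxcol_trAdiag {p} (A : forall i, 'M[R]_(p, q i))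
    (w : 'cV_(\sum_(i < n) p)) i :
  submxcol ((Adiag A)^T *m w) i = (A i)^T *m submxcol w i.
Proof.
rewrite -[w in LHS]submxcolK /Adiag tr_mxblock mxblockEv mxcol_mul mxcolK.
rewrite mul_mxrow_mxcol (bigD1 i)//= eqxx scale1r big1 ?addr0// => j ji.
by rewrite (negPf ji) scale0r trmx0 mul0mx.
Qed.

Lemma Arow_mul {p} (A : forall i, 'M[R]_(p, q i)) u :
  Arow A *m u = \sum_i A i *m submxcol u i.
Proof. by rewrite -[u in LHS]submxcolK /Arow mul_mxrow_mxcol. Qed.

Lemma submxcol_trArow {p} (A : forall i, 'M[R]_(p, q i)) (w : 'cV_p) i :
  submxcol ((Arow A)^T *m w) i = (A i)^T *m w.
Proof. by rewrite /Arow tr_mxrow mxcol_mul mxcolK. Qed.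

End Blocks.

(** * Kronecker products with the identity *)

Section Kronecker.
Context {R : realType} {n p : nat}.
Implicit Types (u v : 'cV[R]_(\sum_(i < n) p)) (M : 'M[R]_n).

(** Slicing across the agents instead of by agent: in these slices [kronI M] acts as [p] independent
    copies of [M]. *)
Definition component (c : 'I_p) u : 'cV[R]_n := \col_i submxcol u i c 0.

Lemma dotp_component u v : dotp u v = \sum_c dotp (component c u) (component c v).
Proof.
rewrite dotp_blocks; under eq_bigr do rewrite dotpE.
rewrite exchange_big; apply: eq_bigr => c _; rewrite dotpE.
by apply: eq_bigr => i _; rewrite !mxE.
Qed.

Lemma sqnorm_component u : sqnorm u = \sum_c sqnorm (component c u).
Proof. exact: dotp_component. Qed.

Lemma componentP u v : (forall c, component c u = component c v) -> u = v.
Proof.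
move=> uv; apply/mxcolP => i; apply/matrixP => c k; rewrite ord1.
by have /matrixP/(_ i 0) := uv c; rewrite !mxE.
Qed.

Lemma submxcol_kronI M u i :
  submxcol (kronI M *m u) i = \sum_j M i j *: submxcol u j.
Proof.
rewrite -[u in LHS]submxcolK /kronI mxblockEv mxcol_mul mxcolK mul_mxrow_mxcol.
by apply: eq_bigr => j _; rewrite mul_scalar_mx.
Qed.

Lemma component_kronI M u c : component c (kronI M *m u) = M *m component c u.
Proof.
apply/matrixP => i k; rewrite ord1 [LHS]mxE submxcol_kronI summxE [RHS]mxE.
by apply: eq_bigr => j _; rewrite !mxE.
Qed.

Lemma kronI_tr M : (kronI M)^T = kronI M^T :> 'M[R]_(\sum_(i < n) p).
Proof.
rewrite /kronI tr_mxblock; apply: eq_mxblock => i j.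
by rewrite tr_scalar_mx mxE.
Qed.

Lemma kronI_psd M : psdmx M -> psdmx (kronI M : 'M[R]_(\sum_(i < n) p)).
Proof.
move=> M0 u; rewrite dotp_component sumr_ge0// => c _.
by rewrite component_kronI; exact: M0.
Qed.

(* The consensus vector [1_n \otimes w]. *)
Definition stack (w : 'cV[R]_p) : 'cV[R]_(\sum_(i < n) p) := \mxcol_i w.

Lemma submxcol_stack w i : submxcol (stack w) i = w.
Proof. by rewrite mxcolK. Qed.

Lemma component_stack w c : component c (stack w) = const_mx (w c 0).
Proof.
by apply/matrixP => i j; rewrite mxE submxcol_stack mxE.
Qed.

Lemma kronI_stack_null M w : null_space M = span_ones ->
  kronI M *m stack w = 0.
Proof.
move=> M1; apply: componentP => c; rewrite component_kronI component_stack.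
have : null_space M (const_mx (w c 0)) by rewrite M1; exists (w c 0).
by move=> ->; apply/matrixP => i j; rewrite !mxE.
Qed.

Lemma kronI_stack_stochastic M w : doubly_stochastic M ->
  kronI M *m stack w = stack w.
Proof.
move=> [_ M1 _]; apply: componentP => c; rewrite component_kronI component_stack.
apply/matrixP => i j; rewrite !mxE.
by under eq_bigr do rewrite mxE; rewrite -mulr_suml M1 mul1r.
Qed.

Lemma kronI_null_consensus M u : null_space M = span_ones ->
  kronI M *m u = 0 -> forall i j, submxcol u i = submxcol u j.
Proof.
move=> M1 Mu i j; apply/matrixP => c k; rewrite ord1.
have : null_space M (component c u).
  rewrite /null_space /= -component_kronI Mu.
  by apply/matrixP => a b; rewrite !mxE.
rewrite M1 => -[a /matrixP ca].
by have := ca i 0; have := ca j 0; rewrite !mxE => -> ->.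
Qed.

End Kronecker.

(** * Ranges as orthogonal complements of kernels *)

Section OrthogonalKernel.
Context {R : realType}.

(** The columns of [cokermx M] lie in the kernel of [M], and being annihilated by them is the
    membership test for the row space. *)
Lemma row_space_of_orth_kernel {m q} (M : 'M[R]_(m, q)) (z : 'cV_q) :
  (forall w, M *m w = 0 -> dotp z w = 0) -> exists u, z = M^T *m u.
Proof.
move=> Hz; have : (z^T <= M)%MS.
  rewrite submxE; apply/eqP/matrixP => i j; rewrite ord1 [RHS]mxE.
  rewrite -(Hz (col j (cokermx M))).
    by rewrite /dotp colE !mulmxA -colE [RHS]mxE.
  by rewrite colE mulmxA mulmx_coker mul0mx.
by move=> /submxP[u zu]; exists u^T; rewrite -trmx_mul -zu trmxK.
Qed.

(** The kernel consists of consensus vectors, and orthogonality to all of these means that the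
    blocks of [z] sum to 0. *)
Lemma kronI_range {n p} (B : 'M[R]_n) (z : 'cV_(\sum_(i < n) p)) : B^T = B ->
  null_space B = span_ones -> \sum_i submxcol z i = 0 ->
  exists u, z = kronI B *m u.
Proof.
move=> symB B1 z0.
suff [w zw] : exists w, z = (kronI B)^T *m w.
  by exists w; rewrite zw kronI_tr symB.
apply: row_space_of_orth_kernel => w Bw; rewrite dotp_blocks.
have [i0 _|n0] := pickP (@predT 'I_n); last by rewrite big1// => i; have := n0 i.
under eq_bigr => i _ do rewrite (kronI_null_consensus B1 Bw i i0).
rewrite -(big_morph (fun x => dotp x _) (fun _ _ => dotpDl _ _ _) (dotp0l _)).
by rewrite z0 dotp0l.
Qed.

Lemma sv_min_nz_range {n} (B : 'M[R]_n) : (1 < n)%N -> B^T = B ->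
  null_space B = span_ones ->
  0 < sv_min_nz B /\
  forall u, sv_min_nz B ^+ 2 * sqnorm (B *m u) <= sqnorm (B *m (B *m u)).
Proof.
move=> n1 symB B1; have n0 := ltnW n1.
set one : 'cV[R]_n := const_mx 1.
have Bone : B *m one = 0.
  by have : null_space B one by rewrite B1; exists 1.
have [c c0 Bc] := quadratic_form_bounded (B^T *m B).
pose S := B^T *m B + (c + 1) *: (one *m one^T).
have SE v : S *m v = B^T *m B *m v + ((c + 1) * dotp one v) *: one.
  rewrite mulmxDl -scalemxAl -[one *m _ *m v]mulmxA (mx11_scalar (one^T *m v)).
  by rewrite mul_mx_scalar -/(dotp one v) scalerA.
have symS : S^T = S.
  by rewrite linearD /= linearZ /= gram_sym trmx_mul trmxK.
have Squad v : dotp v (S *m v) = sqnorm (B *m v) + (c + 1) * dotp one v ^+ 2.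
  by rewrite SE dotpDr dotp_gram dotpZr (dotpC v) expr2 mulrA.
have oneB u : dotp one (B *m u) = 0.
  by rewrite dotp_trmx symB Bone dotp0l.
have c1 : 0 < c + 1 by rewrite ltr_wpDl.
have [a ea aS] := rayleigh_min n0 symS.
have /(eigenvalue_symP _ symS)[v Sv v0] := ea.
have aSv : a * sqnorm v = sqnorm (B *m v) + (c + 1) * dotp one v ^+ 2.
  by rewrite -Squad Sv dotpZr.
(* With at least two agents, a basis vector is not constant, hence not in the kernel. *)
have [w Bw] : exists w : 'cV[R]_n, B *m w != 0.
  pose w : 'cV[R]_n := delta_mx (Ordinal n0) 0.
  exists w; apply/eqP => Bw; have : null_space B w by [].
  rewrite B1 => -[b /matrixP wb]; have := wb (Ordinal n0) 0.
  have := wb (Ordinal n1) 0; rewrite !mxE /= => <- /eqP.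
  by rewrite oner_eq0.
(* Otherwise pairing [S *m v = a *: v] with [one] yields a = (c + 1) n, whereas the Rayleigh
   quotient of [S] at [B *m w] is at most c. *)
have sv1 : dotp one v = 0.
  have [//|s0] := eqVneq (dotp one v) 0; exfalso.
  have : dotp one (S *m v) = (c + 1) * dotp one v * n%:R.
    rewrite SE dotpDr -mulmxA symB oneB add0r dotpZr; congr (_ * _).
    rewrite dotpE; under eq_bigr do rewrite !mxE mulr1.
    by rewrite sumr_const card_ord.
  rewrite Sv dotpZr mulrAC => /(mulIf s0) aE.
  have := aS (B *m w); rewrite Squad oneB expr0n mulr0 addr0 aE => H.
  have := Bc (B *m w); rewrite dotp_gram ger0_norm ?sqnorm_ge0// => H2.
  have w0 := sqnorm_gt0 Bw.
  have : (c + 1) * n%:R <= c by rewrite -(ler_pM2r w0); exact: le_trans H H2.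
  have : (c + 1) * 1 <= (c + 1) * n%:R by rewrite ler_pM2l// ler1n.
  lra.
have a0 : 0 < a.
  rewrite -(pmulr_lgt0 _ (sqnorm_gt0 v0)) aSv sv1 expr0n mulr0 addr0.
  apply: sqnorm_gt0; apply/eqP => Bv; have : null_space B v by [].
  rewrite B1 => -[b vb]; move: sv1 v0; rewrite vb dotpE.
  under eq_bigr do rewrite !mxE mul1r.
  rewrite sumr_const card_ord => /eqP; rewrite mulrn_eq0 gtn_eqF//= => /eqP ->.
  by rewrite eqxx.
have range_le u : a * sqnorm (B *m u) <= sqnorm (B *m (B *m u)).
  by have := aS (B *m u); rewrite Squad oneB expr0n mulr0 addr0.
pose X := [set s | singular_values B s /\ s != 0].
have Xa : X (Num.sqrt a).
  split; last by rewrite gt_eqF// sqrtr_gt0.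
  split; rewrite ?sqrtr_ge0// sqr_sqrtr ?ltW//.
  apply/(eigenvalue_symP _ (gram_sym B)); exists v => //.
  by rewrite -Sv SE sv1 mulr0 scale0r addr0.
(* An eigenvector of [B^T *m B] for s^2 != 0 lies in the range of [B], hence is orthogonal to [one];
   on it [S] acts as [B^T *m B], so a <= s^2. *)
have lbX : lbound X (Num.sqrt a).
  move=> s [[s0 /(eigenvalue_symP _ (gram_sym B))[z Bz z0]] sn0].
  have s2 : 0 < s ^+ 2 by rewrite exprn_gt0// lt_neqAle eq_sym sn0.
  rewrite -(ger0_norm s0) -sqrtr_sqr ler_wsqrtr//.
  rewrite -(ler_pM2r (sqnorm_gt0 z0)).
  have := aS z; rewrite SE Bz (_ : dotp one z = 0) ?mulr0 ?scale0r ?addr0 ?dotpZr//.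
  apply: (mulfI (lt0r_neq0 s2)).
  by rewrite mulr0 -dotpZr -Bz -mulmxA symB oneB.
suff -> : sv_min_nz B = Num.sqrt a by rewrite sqr_sqrtr ?ltW// sqrtr_gt0.
apply/eqP; rewrite eq_le; apply/andP; split.
  by apply: ge_inf => //; exists (Num.sqrt a).
by apply: lb_le_inf => //; exists (Num.sqrt a).
Qed.

End OrthogonalKernel.

(** * Extrema of finite families *)

Section FiniteExtrema.
Context {R : realType} {n : nat}.
Implicit Types F : 'I_n -> R.

Lemma fmaxP F : (0 < n)%N -> (exists i, fmax F = F i) /\ forall i, F i <= fmax F.
Proof.
move=> n0; have [i _ iF] := @arg_maxP _ _ _ (Ordinal n0) predT F isT.
have ub : ubound (range F) (F i) by move=> _ [j _ <-]; exact: iF.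
suff -> : fmax F = F i by split => [|j]; [exists i|exact: iF].
apply/eqP; rewrite eq_le; apply/andP; split.
  by apply: ge_sup => //; exists (F i); exists i.
by apply: ub_le_sup; [exists (F i)|exists i].
Qed.

Lemma fminP F : (0 < n)%N -> (exists i, fmin F = F i) /\ forall i, fmin F <= F i.
Proof.
move=> n0; have [i _ iF] := @arg_minP _ _ _ (Ordinal n0) predT F isT.
have lb : lbound (range F) (F i) by move=> _ [j _ <-]; exact: iF.
suff -> : fmin F = F i by split => [|j]; [exists i|exact: iF].
apply/eqP; rewrite eq_le; apply/andP; split.
  by apply: ge_inf; [exists (F i)|exists i].
by apply: lb_le_inf => //; exists (F i); exists i.
Qed.

End FiniteExtrema.


(** * One-step contraction of the Lyapunov function *)

Section Contraction.
Context {R : realType}.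

(* Completing the square gives [|v|^2 + 2 <By, v> = |w|^2 - |By|^2]. *)
Lemma dual_descent {N} (B : 'M[R]_N) (gamma : R) (lam' w y : 'cV_N) :
  B^T = B -> 0 < gamma < 1 ->
  let v := w - B *m y in
  sqnorm lam' <= sqnorm v - sqnorm (B *m v) ->
  sqnorm lam' + gamma^-1 * sqnorm (y + gamma *: (B *m v))
    <= sqnorm w + gamma^-1 * sqnorm y - sqnorm (B *m y).
Proof.
move=> symB /andP[g0 g1] v lam'_le.
have yBv : dotp y (B *m v) = dotp w (B *m y) - sqnorm (B *m y).
  by rewrite dotp_trmx symB dotpC /v dotpDl dotpNl.
have vv : sqnorm v = sqnorm w - 2 * dotp w (B *m y) + sqnorm (B *m y).
  by rewrite /sqnorm /v !dotp_lin (dotpC _ w); lra.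
have -> : sqnorm (y + gamma *: (B *m v)) = sqnorm y
    + gamma * (2 * dotp y (B *m v) + gamma * sqnorm (B *m v)).
  by rewrite /sqnorm !dotp_lin (dotpC _ y); ring.
rewrite mulrDr mulKf ?gt_eqF// yBv.
have : gamma * sqnorm (B *m v) <= sqnorm (B *m v).
  by rewrite ler_piMl ?sqnorm_ge0// ltW.
lra.
Qed.

(** Here [c] stands for C lam. Expanding |lam - c|^2 frees 2 <lam, c> - |c|^2: the product <c, a>
    uses up <lam, c> - |c|^2, the product <c, b> uses up <lam, c> / 2, and <lam, c> / 2 remains. The
    product <a, b> is split evenly. *)
Lemma mixing_bound {N} (s theta : R) (lam c a b : 'cV[R]_N) :
  0 <= s < 1 -> 0 <= theta ->
  sqnorm c <= s * dotp lam c ->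
  sqnorm (lam - c + (a + theta *: b)) <= sqnorm lam - dotp lam c / 2
    + 2 * dotp lam (a + theta *: b)
    + ((1 - s)^-1 + theta) * sqnorm a
    + theta * (1 + 3 * theta) * sqnorm b.
Proof.
move=> /andP[s0 s1] th0 cs.
have s1' : 0 < 1 - s by rewrite subr_gt0.
have cross_a : - 2 * dotp c a <= s / (1 - s) * sqnorm a + (dotp lam c - sqnorm c).
  have [sz|sn0] := eqVneq s 0.
    have c0 : c = 0 by apply: sqnorm_le0; rewrite (le_trans cs)// sz mul0r.
    by rewrite sz c0 /sqnorm !dotp0r !dotp0l; lra.
  have sp : 0 < s by rewrite lt_neqAle eq_sym sn0.
  (* After division by s (1 - s), the term (1 - s) / s |c|^2 is at most <lam, c> - |c|^2, because
     |c|^2 / s <= <lam, c>. *)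
  have := sqnorm_ge0 (s *: a + (1 - s) *: c).
  rewrite /sqnorm !dotp_lin (dotpC a c) -!sqnormE => H.
  rewrite -(ler_pM2l (mulr_gt0 sp s1')).
  have -> : s * (1 - s) * (s / (1 - s) * sqnorm a + (dotp lam c - sqnorm c))
    = s ^+ 2 * sqnorm a + s * (1 - s) * (dotp lam c - sqnorm c).
    by field; rewrite gt_eqF.
  have := ler_wpM2l (ltW s1') cs; lra.
have cross_b : - 2 * theta * dotp c b
    <= dotp lam c / 2 + 2 * theta ^+ 2 * sqnorm b.
  have := sqnorm_ge0 (c + (2 * theta) *: b).
  rewrite /sqnorm !dotp_lin (dotpC b c) -!sqnormE.
  have lc : 0 <= dotp lam c.
    have [sz|sn0] := eqVneq s 0.
      have -> : c = 0 by apply: sqnorm_le0; rewrite (le_trans cs)// sz mul0r.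
      by rewrite dotp0r.
    have sp : 0 < s by rewrite lt_neqAle eq_sym sn0.
    by rewrite -(pmulr_rge0 _ sp) (le_trans _ cs)// sqnorm_ge0.
  have : s * dotp lam c <= dotp lam c by rewrite ler_piMl// ltW.
  lra.
have := mulr_ge0 th0 (sqnorm_ge0 (a - b)).
rewrite /sqnorm !dotp_lin (dotpC b a) (dotpC c lam) (dotpC a lam) (dotpC b lam).
rewrite (dotpC a c) (dotpC b c) -!sqnormE.
have -> : (1 - s)^-1 = 1 + s / (1 - s) by field; rewrite gt_eqF.
move: cross_a cross_b; lra.
Qed.

(** Here [z] stands for A^T lam. The added multiple of |dx|^2 makes <G, z> cancel along with <x, z>,
    leaving a difference of squares. *)
Lemma primal_identity {q} (alpha beta theta : R) (x G z : 'cV[R]_q) :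
  alpha != 0 ->
  let dx := - (alpha *: (G + z)) in
  beta / alpha * sqnorm (x + dx) + 2 * beta * dotp z (x + dx + theta *: dx)
    + beta * theta / alpha * sqnorm dx
  = beta / alpha * sqnorm x - 2 * beta * dotp x G
    + alpha * beta * (1 + theta) * (sqnorm G - sqnorm z).
Proof.
move=> a0 dx; rewrite /sqnorm /dx !dotp_lin (dotpC z x) (dotpC G x) (dotpC z G).
by field.
Qed.

Section Lyapunov.
Context {N q : nat}.
Variables (A : 'M[R]_(N, q)) (B C : 'M[R]_N).
Variables (alpha beta gamma theta s : R).

Definition lyapunov (x : 'cV[R]_q) (y lam : 'cV[R]_N) : R :=
  beta / alpha * sqnorm x
  - ((1 - s)^-1 + theta) * beta ^+ 2 * sqnorm (A *m x)
  + (sqnorm lam + gamma^-1 * sqnorm y).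

(** The bound on [beta] keeps the subtracted term below beta mu |x|^2, so the Lyapunov function
    controls |x|^2 once alpha mu < 1. *)
Lemma lyapunov_ge (a2 mu : R) x y lam : 0 < beta -> 0 < gamma ->
  (forall w, sqnorm (A *m w) <= a2 * sqnorm w) ->
  0 <= (1 - s)^-1 + theta ->
  beta * (a2 * ((1 - s)^-1 + theta)) <= mu ->
  beta * (alpha^-1 - mu) * sqnorm x <= lyapunov x y lam.
Proof.
move=> b0 g0 Aa k0 beta_le; rewrite /lyapunov -[leLHS]addr0 lerD//; last first.
  by rewrite addr_ge0 ?mulr_ge0 ?sqnorm_ge0// invr_ge0 ltW.
have H := ler_wpM2l (mulr_ge0 k0 (sqr_ge0 beta)) (Aa x).
have := ler_wpM2r (mulr_ge0 (ltW b0) (sqnorm_ge0 x)) beta_le.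
lra.
Qed.

Lemma lyapunov_contraction (a2 mu l eta b2 delta : R)
    (x x' G : 'cV[R]_q) (y lam lam' : 'cV[R]_N) :
  B^T = B -> 0 <= s < 1 -> 0 < mu <= l -> 0 <= theta -> 0 < alpha ->
  0 < beta -> 0 < gamma < 1 -> 0 <= a2 ->
  (forall w, sqnorm (A *m w) <= a2 * sqnorm w) ->
  beta * (a2 * ((1 - s)^-1 + theta)) <= mu ->
  alpha * l * (1 + 2 * theta) < 1 ->
  sqnorm (C *m lam) <= s * dotp lam (C *m lam) ->
  b2 * sqnorm y <= sqnorm (B *m y) ->
  eta * sqnorm lam <= sqnorm (A^T *m lam)
    + (2 * alpha * beta)^-1 * dotp lam (C *m lam) ->
  mu * sqnorm x <= dotp x G -> sqnorm G <= l * dotp x G ->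
  1 - alpha * mu * (1 - alpha * l * (1 + 2 * theta)) <= delta ->
  1 - alpha * beta * eta <= delta -> 1 - gamma * b2 <= delta ->
  x' = x - alpha *: (G + A^T *m lam) ->
  let v := lam - C *m lam - B *m y + beta *: (A *m (x' + theta *: (x' - x))) in
  sqnorm lam' <= sqnorm v - sqnorm (B *m v) ->
  lyapunov x' (y + gamma *: (B *m v)) lam' <= delta * lyapunov x y lam.
Proof.
move=> symB s01 /andP[mu0 mul] th0 a0 b0 g01 a20 Aa beta_le alphaL Cs yB lamE.
move=> xG_ge G_le d1 d2 d3 x'E v lam'_le.
have /andP[g0 g1] := g01; have /andP[s0 s1] := s01.
have l0 := lt_le_trans mu0 mul.
set kappa := (1 - s)^-1 + theta.
have s1i : 1 <= (1 - s)^-1 by rewrite invf_ge1 ?subr_gt0// gerBl.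
have k1 : 1 + theta <= kappa by rewrite lerD2r.
have k0 : 0 <= kappa by rewrite (le_trans _ k1)// addr_ge0.
pose z := A^T *m lam; pose dx := - (alpha *: (G + z)).
have x'dx : x' = x + dx by [].
have dxE : x' - x = dx by rewrite x'dx addrAC subrr add0r.
pose w := lam - C *m lam + (beta *: (A *m x') + theta *: (beta *: (A *m dx))).
have vE : v = w - B *m y.
  rewrite /v /w dxE mulmxDr -scalemxAr scalerDr !scalerA [theta * _]mulrC.
  by rewrite addrAC.
move: lam'_le; rewrite vE => lam'_le.
have := dual_descent symB g01 lam'_le; set y' := y + _ => dual.
have mix := mixing_bound (beta *: (A *m x')) (beta *: (A *m dx)) s01 th0 Cs.
rewrite -/w in mix.
have prim : beta / alpha * sqnorm x' + 2 * beta * dotp z (x' + theta *: dx)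
    + beta * theta / alpha * sqnorm dx = beta / alpha * sqnorm x
    - 2 * beta * dotp x G + alpha * beta * (1 + theta) * (sqnorm G - sqnorm z).
  by rewrite x'dx; exact: primal_identity (lt0r_neq0 a0).
have dotz u : dotp lam (A *m u) = dotp z u by rewrite dotp_trmx.
move: mix; rewrite !sqnormZ dotpDr !dotpZr !dotz => mix.
move: prim; rewrite dotpDr dotpZr => prim.
have xG0 : 0 <= dotp x G by apply: le_trans xG_ge; rewrite mulr_ge0 ?sqnorm_ge0 ?ltW.
(* The extrapolation error of [mixing_bound] is paid for by the |dx|^2 term of [primal_identity],
   using 1 + 3 theta <= (1 + theta) (1 + 2 theta). *)
have Adx : theta * (1 + 3 * theta) * (beta ^+ 2 * sqnorm (A *m dx)) <=
    beta * theta / alpha * sqnorm dx.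
  have h1 : beta * a2 * (1 + theta) <= l.
    apply: le_trans mul; apply: le_trans beta_le.
    rewrite -mulrA ler_wpM2l ?(ltW b0)//.
    by rewrite ler_wpM2l.
  have h2 : alpha * (beta * a2 * (1 + 3 * theta)) <= 1.
    apply: le_trans (ltW alphaL); rewrite -[leRHS]mulrA ler_pM2l//.
    apply: (@le_trans _ _ (beta * a2 * (1 + theta) * (1 + 2 * theta))).
      rewrite -[leRHS]mulrA ler_wpM2l ?(mulr_ge0 (ltW b0))//; have := sqr_ge0 theta; lra.
    by rewrite ler_wpM2r// addr_ge0// mulr_ge0.
  have h3 : 0 <= theta * (1 + 3 * theta) * beta ^+ 2.
    by rewrite mulr_ge0 ?sqr_ge0// mulr_ge0// addr_ge0// mulr_ge0.
  rewrite mulrA; apply: le_trans (ler_wpM2l h3 (Aa dx)) _.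
  rewrite [_ / alpha]mulrC -[alpha^-1 * _ * _]mulrA ler_pdivlMl//.
  have := ler_wpM2r (mulr_ge0 (mulr_ge0 (ltW b0) th0) (sqnorm_ge0 dx)) h2; lra.
(* Cocoercivity, with 1 + theta weakened to 1 + 2 theta so that the coefficient is beta times the
   [L] below. *)
have GxG : alpha * beta * (1 + theta) * sqnorm G <=
    alpha * beta * l * (1 + 2 * theta) * dotp x G.
  have h : 0 <= alpha * beta by rewrite mulr_ge0 ?ltW.
  apply: (@le_trans _ _ (alpha * beta * (1 + theta) * (l * dotp x G))).
    by rewrite ler_wpM2l// mulr_ge0// addr_ge0.
  have : 0 <= alpha * beta * theta * (l * dotp x G).
    by rewrite !mulr_ge0 ?(ltW a0) ?(ltW b0) ?(ltW l0).
  lra.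
set L := alpha * l * (1 + 2 * theta).
have xG2 : beta * mu * (2 - L) * sqnorm x <= beta * (2 - L) * dotp x G.
  have h : 0 <= beta * (2 - L).
    by rewrite mulr_ge0 ?ltW//; rewrite subr_gt0 (lt_trans alphaL)// ltr1n.
  have := ler_wpM2l h xG_ge; lra.
have kA : kappa * beta ^+ 2 * sqnorm (A *m x) <= beta * mu * sqnorm x.
  have H := ler_wpM2l (mulr_ge0 k0 (sqr_ge0 beta)) (Aa x).
  have := ler_wpM2r (mulr_ge0 (ltW b0) (sqnorm_ge0 x)) beta_le; rewrite -/kappa.
  lra.
have kA0 : 0 <= kappa * beta ^+ 2 * sqnorm (A *m x).
  by rewrite mulr_ge0 ?sqnorm_ge0// mulr_ge0 ?sqr_ge0.
have amu1 : alpha * mu <= 1.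
  have : alpha * mu <= alpha * l by rewrite ler_wpM2l// ltW.
  have : 0 <= alpha * l * (2 * theta) by rewrite !mulr_ge0 ?(ltW a0) ?(ltW l0).
  move: alphaL; lra.
set X := beta / alpha * sqnorm x - kappa * beta ^+ 2 * sqnorm (A *m x).
(* Nonnegativity allows the contraction factor of this part to be raised to [delta]. *)
have X0 : 0 <= X.
  have : alpha * mu * (beta / alpha * sqnorm x) <= beta / alpha * sqnorm x.
    by rewrite ler_piMl// !mulr_ge0 ?invr_ge0 ?sqnorm_ge0 ?ltW.
  have -> : alpha * mu * (beta / alpha * sqnorm x) = beta * mu * sqnorm x.
    by field; rewrite gt_eqF.
  rewrite /X; move: kA; lra.
(* Of the factor 2 - L, the part 1 - L produces the rate, and the remaining 1 pays for kappa beta^2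
   |A x|^2 through [kA]. *)
have dX : beta / alpha * sqnorm x - beta * mu * (2 - L) * sqnorm x <= delta * X.
  apply: le_trans (ler_wpM2r X0 d1); rewrite -/L.
  have -> : (1 - alpha * mu * (1 - L)) * X = beta / alpha * sqnorm x
     - beta * mu * (1 - L) * sqnorm x - kappa * beta ^+ 2 * sqnorm (A *m x)
     + alpha * mu * (1 - L) * (kappa * beta ^+ 2 * sqnorm (A *m x)).
    by rewrite /X; field; rewrite gt_eqF.
  have : 0 <= alpha * mu * (1 - L) * (kappa * beta ^+ 2 * sqnorm (A *m x)).
    rewrite mulr_ge0// mulr_ge0 ?(mulr_ge0 (ltW a0) (ltW mu0))//.
    by rewrite subr_ge0 ltW.
  move: kA; lra.
(* Multiplying [lamE] by alpha beta turns its weight 1 / (2 alpha beta) into exactly the 1 / 2 left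
   over by [mixing_bound]. *)
have dlam : sqnorm lam - dotp lam (C *m lam) / 2 - alpha * beta * sqnorm z
    <= delta * sqnorm lam.
  apply: le_trans (ler_wpM2r (sqnorm_ge0 lam) d2).
  have := ler_wpM2l (mulr_ge0 (ltW a0) (ltW b0)) lamE; rewrite -/z mulrDr.
  have -> : alpha * beta * ((2 * alpha * beta)^-1 * dotp lam (C *m lam))
    = dotp lam (C *m lam) / 2 by field; rewrite !gt_eqF.
  lra.
have dy : gamma^-1 * sqnorm y - sqnorm (B *m y) <= delta * (gamma^-1 * sqnorm y).
  have gy : 0 <= gamma^-1 * sqnorm y by rewrite mulr_ge0 ?sqnorm_ge0// invr_ge0 ltW.
  apply: le_trans (ler_wpM2r gy d3).
  have -> : (1 - gamma * b2) * (gamma^-1 * sqnorm y) = gamma^-1 * sqnorm y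
     - b2 * sqnorm y by field; rewrite gt_eqF.
  move: yB; lra.
have thz : 0 <= alpha * beta * theta * sqnorm z.
  by rewrite !mulr_ge0 ?(ltW a0) ?(ltW b0) ?sqnorm_ge0.
rewrite /lyapunov -/kappa; move: dual mix prim Adx GxG xG2 dX dlam dy thz.
by rewrite -/kappa /X /L; lra.
Qed.

End Lyapunov.

End Contraction.


(** * Proximal points *)

Section Prox.
Context {R : realType} {m : nat}.
Implicit Types (phi : 'cV[R]_m -> \bar R) (x y z w : 'cV[R]_m).

Lemma prox_nonexpansive phi (beta r0 : R) w z z0 s : 0 < beta ->
  (forall x y a b t, 0 < t < 1 -> phi x = a%:E -> phi y = b%:E ->
    (phi (t *: x + (1 - t) *: y)%R <= (t * a + (1 - t) * b)%:E)%E) ->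
  phi z0 = r0%:E -> (forall y, ((r0 + dotp s (y - z0))%:E <= phi y)%E) ->
  prox beta phi w z -> sqnorm (z - z0) <= sqnorm (w - (z0 + beta *: s)).
Proof.
move=> b0 cvx phiz0 sub zP; set c := (2 * beta)^-1 in zP.
have [a phiz] : exists a, phi z = a%:E.
  have := sub z; have := zP z0; rewrite phiz0 /= -EFinD.
  by case: (phi z) => [a|//|//]; exists a.
have za : r0 + dotp s (z - z0) <= a by have := sub z; rewrite phiz lee_fin.
(* First-order optimality of [z] towards [z0], from comparison with points of the segment near
   [z]. *)
have opt : 0 <= r0 - a + 2 * c * dotp (z0 - z) (z - w).
  apply: (@ge0_of_small_slope _ _ (c * sqnorm (z0 - z))) => N.
  set t : R := N.+2%:R^-1.
  have t0 : 0 < t by rewrite invr_gt0 ltr0n.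
  have t1 : t < 1 by rewrite invf_lt1 ?ltr1n ?ltr0n.
  have t01 : 0 < t < 1 by rewrite t0.
  have := cvx z0 z r0 a t t01 phiz0 phiz.
  have := zP (t *: z0 + (1 - t) *: z); rewrite phiz /=.
  case: (phi (t *: z0 + (1 - t) *: z)) => [b|//|//]; rewrite !lee_fin => H1 H2.
  have zt : t *: z0 + (1 - t) *: z - w = t *: (z0 - z) + (z - w).
    by apply/matrixP => i j; rewrite !mxE; ring.
  have sq : sqnorm (t *: (z0 - z) + (z - w)) = t ^+ 2 * sqnorm (z0 - z)
      + 2 * t * dotp (z0 - z) (z - w) + sqnorm (z - w).
    by rewrite [LHS]sqnormD sqnormZ dotpZl mulrA.
  rewrite zt sq in H1.
  rewrite -(pmulr_rge0 _ t0); move: H1 H2; rewrite -/c; lra.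
set u := w - (z0 + beta *: s).
(* Firm nonexpansiveness; expanding |z - z0 - u|^2 >= 0 then gives the claim. *)
have key : sqnorm (z - z0) <= dotp u (z - z0).
  have cb : 2 * c = beta^-1 by rewrite /c invfM mulrA divff ?mul1r.
  rewrite cb in opt.
  have : 0 <= beta * (- dotp s (z - z0) + beta^-1 * dotp (z0 - z) (z - w)).
    by rewrite pmulr_rge0//; move: opt za; lra.
  have -> : dotp (z0 - z) (z - w) = - (sqnorm (z - z0) + dotp (z - z0) (z0 - w)).
    by rewrite /sqnorm -dotpDr subrKA -dotpNl opprB.
  have -> : dotp u (z - z0) = - dotp (z - z0) (z0 - w) - beta * dotp s (z - z0).
    rewrite (_ : u = - (z0 - w) - beta *: s); last by rewrite /u opprB opprD addrA.
    by rewrite [LHS]dotpDl !dotpNl dotpZl (dotpC (z0 - w)).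
  by rewrite mulrDr mulVKf ?gt_eqF//; lra.
have := sqnorm_ge0 (z - z0 - u); rewrite sqnormD dotpNr.
rewrite /sqnorm dotpNl dotpNr opprK -!sqnormE (dotpC (z - z0) u); lra.
Qed.

Lemma prox0 phi (alpha : R) w z : 0 < alpha -> (forall x, phi x = 0%E) ->
  prox alpha phi w z -> z = w.
Proof.
move=> a0 phi0 /(_ w); rewrite !phi0 !add0e subrr lee_fin {2}/sqnorm dotp0r mulr0.
rewrite pmulr_rle0 ?invr_gt0 ?mulr_gt0// => /sqnorm_le0/eqP.
by rewrite subr_eq0 => /eqP.
Qed.

End Prox.

(** * Fenchel conjugates *)

Section Fenchel.
Context {R : realType} {p : nat}.
Variable h : 'cV[R]_p -> \bar R.

Lemma fenchel_ge y r s : h y = r%:E -> ((dotp s y - r)%:E <= fenchel h s)%E.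
Proof. by move=> hy; apply: ereal_sup_ubound; exists y => //; rewrite hy. Qed.

(** The equality case of Fenchel-Young: a subgradient at [y0] makes [y0] a maximizer in the
    conjugate. *)
Lemma fenchel_subgradient y0 r s : h y0 = r%:E ->
  (forall y, ((r + dotp s (y - y0))%:E <= h y)%E) ->
  fenchel h s = (dotp s y0 - r)%:E.
Proof.
move=> hy0 sub; apply/eqP; rewrite eq_le fenchel_ge// andbT.
apply: ge_ereal_sup => _ [y _ <-]; have := sub y.
case: (h y) => [a|_|//] /=; last by rewrite leNye.
by rewrite !lee_fin dotpDr dotpNr; lra.
Qed.

Lemma fenchel_convex s1 s2 a b (t : R) : 0 < t < 1 ->
  fenchel h s1 = a%:E -> fenchel h s2 = b%:E ->
  (fenchel h (t *: s1 + (1 - t) *: s2)%R <= (t * a + (1 - t) * b)%:E)%E.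
Proof.
move=> /andP[t0 t1] h1 h2; apply: ge_ereal_sup => _ [y _ <-].
have H1 : ((dotp s1 y)%:E - h y <= a%:E)%E.
  by rewrite -h1; apply: ereal_sup_ubound; exists y.
have H2 : ((dotp s2 y)%:E - h y <= b%:E)%E.
  by rewrite -h2; apply: ereal_sup_ubound; exists y.
move: H1 H2; case: (h y) => [c|_ _|//] /=; last by rewrite leNye.
rewrite !lee_fin dotpDl !dotpZl => H1 H2.
have t1' : 0 <= 1 - t by rewrite subr_ge0 ltW.
by have := ler_wpM2l (ltW t0) H1; have := ler_wpM2l t1' H2; lra.
Qed.

End Fenchel.

(** * The averaged conjugate *)

Section Havg.
Context {R : realType} {n p : nat}.
Variable h : 'cV[R]_p -> \bar R.
Hypothesis n0 : (0 < n)%N.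
Implicit Types u v : 'cV[R]_(\sum_(i < n) p).

Lemma havg_fin u : (forall i, fenchel h (submxcol u i) \is a fin_num) ->
  havg h u = (n%:R^-1 * \sum_i fine (fenchel h (submxcol u i)))%:E.
Proof. by move=> uf; rewrite /havg -EFin_sum_fine. Qed.

Lemma havg_finP u a : havg h u = a%:E ->
  forall i, fenchel h (submxcol u i) \is a fin_num.
Proof.
have ni : 0 < n%:R^-1 :> R by rewrite invr_gt0 ltr0n.
rewrite /havg => ua i; have : (\sum_i fenchel h (submxcol u i))%E \is a fin_num.
  move: ua; case: (\sum_i _)%E => [//| |].
    by rewrite gt0_muley ?lte_fin.
  by rewrite gt0_muleNy ?lte_fin.
by move=> /sum_fin_numP/(_ i); apply; rewrite ?mem_index_enum.
Qed.

Lemma havg_convex u v a b (t : R) : 0 < t < 1 ->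
  havg h u = a%:E -> havg h v = b%:E ->
  (havg h (t *: u + (1 - t) *: v)%R <= (t * a + (1 - t) * b)%:E)%E.
Proof.
move=> t01 ua vb; have uf := havg_finP ua; have vf := havg_finP vb.
move: ua vb; rewrite (havg_fin uf) (havg_fin vf) => ua vb.
have <- := EFin_inj ua; have <- := EFin_inj vb.
rewrite (mulrCA t) (mulrCA (1 - t)) -mulrDr !mulr_sumr -big_split /=.
rewrite EFinM -sumEFin /havg lee_pmul2l//; last first.
  by rewrite lte_fin invr_gt0 ltr0n.
apply: lee_sum => i _; rewrite submxcolD !submxcolZ.
by apply: fenchel_convex => //; rewrite fineK.
Qed.

(** Fenchel-Young makes [y0] a subgradient of the conjugate at [s]; the weight 1 / n of the average
    scales it in every block. *)
Lemma havg_subgradient y0 r s : h y0 = r%:E ->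
  (forall y, ((r + dotp s (y - y0))%:E <= h y)%E) ->
  havg h (stack s : 'cV_(\sum_(i < n) p)) = (dotp s y0 - r)%:E /\
  forall u, ((dotp s y0 - r + dotp (stack (n%:R^-1 *: y0)) (u - stack s))%:E
    <= havg h u)%E.
Proof.
move=> hy0 sub; have n0R : n%:R != 0 :> R by rewrite pnatr_eq0 -lt0n.
have hs := fenchel_subgradient hy0 sub; split => [|u].
  rewrite havg_fin => [|i]; last by rewrite submxcol_stack hs.
  under eq_bigr do rewrite submxcol_stack hs.
  by rewrite /= sumr_const card_ord -(mulr_natl (dotp s y0 - r)) mulrA mulVf ?mul1r.
have -> : dotp s y0 - r + dotp (stack (n%:R^-1 *: y0)) (u - stack s)
   = n%:R^-1 * \sum_i (dotp (submxcol u i) y0 - r).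
  rewrite dotp_blocks; under eq_bigr do
    rewrite submxcolB !submxcol_stack dotpZl dotpDr dotpNr (dotpC y0) (dotpC y0 s).
  rewrite -mulr_sumr !big_split /= !sumrN !sumr_const card_ord.
  by rewrite -(mulr_natl (dotp s y0)) -(mulr_natl r); field.
rewrite EFinM -sumEFin /havg lee_pmul2l//; last first.
  by rewrite lte_fin invr_gt0 ltr0n.
by apply: lee_sum => i _; exact: fenchel_ge.
Qed.

End Havg.


(** * Optimality conditions and definiteness of the dual matrix *)

Section KKT.
Context {R : realType} {n p : nat} {d : 'I_n -> nat}.
Variables (f : forall i, 'cV[R]_(d i) -> R) (h : 'cV[R]_p -> \bar R).
Arguments f : clear implicits.
Variables (A : forall i, 'M[R]_(p, d i)) (l : 'I_n -> R).
Hypothesis f_cvx : forall i, strongly_convex 0 (f i).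
Hypothesis f_smooth : forall i, smooth (l i) (f i).
Hypothesis A_full : row_free (Arow A).

(** Blockwise descent lemma. Only independence of [c] from [t] matters, since the remainder
    disappears in [ge0_of_small_slope]. *)
Lemma fsum_le x w : exists c, forall t : R,
  fsum f (x + t *: w) <= fsum f x + t * dotp (grad (fsum f) x) w + t ^+ 2 * c.
Proof.
exists (\sum_i l i / 2 * sqnorm (submxcol w i)) => t.
rewrite /fsum dotp_blocks !mulr_sumr -!big_split /=; apply: ler_sum => i _.
rewrite submxcol_grad_fsum submxcolD submxcolZ.
have := smooth_le (submxcol x i) (submxcol x i + t *: submxcol w i)
  (@f_cvx i) (@f_smooth i).
rewrite [_ + t *: _]addrC addrK dotpZr sqnormZ; lra.
Qed.

Lemma Arow_onto (y : 'cV_p) : exists x, Arow A *m x = y.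
Proof.
by have [M AM] := row_freeP A_full; exists (M *m y); rewrite mulmxA AM mul1mx.
Qed.

Lemma Arow_free_eq0 (w : 'cV_p) : (Arow A)^T *m w = 0 -> w = 0.
Proof.
move=> Aw; apply: trmx_inj; apply/eqP; rewrite trmx0 -(mulmx_free_eq0 _ A_full).
by rewrite -[_ *m Arow A]trmxK trmx_mul trmxK Aw trmx0.
Qed.

(* Full row rank of A makes the constraint qualification automatic: the
   gradient at the optimum vanishes on Null(A), and its preimage under A^T is
   a subgradient of h because A is onto. *)
Lemma kkt_multiplier (g : forall i, 'cV[R]_(d i) -> \bar R)
    (xs : 'cV_(\sum_(i < n) d i)) :
  (forall i x, g i x = 0%E) -> Defs.proper h -> econvex h ->
  argmin (objective f g h A) xs ->
  exists lam r, [/\ grad (fsum f) xs = - ((Arow A)^T *m lam),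
    h (Arow A *m xs) = r%:E &
    forall y, ((r + dotp lam (y - Arow A *m xs))%:E <= h y)%E].
Proof.
move=> g0 [hNy [y1 hy1]] hcvx xsP.
have objE x : objective f g h A x = ((fsum f x)%:E + h (Arow A *m x))%E.
  rewrite /objective Arow_mul; congr (_ + _)%E.
  by rewrite /fsum -sumEFin; apply: eq_bigr => i _; rewrite g0 adde0.
have [x1 Ax1] := Arow_onto y1.
have [r hr] : exists r, h (Arow A *m xs) = r%:E.
  have := xsP x1; rewrite !objE Ax1; move: hy1 (hNy y1) (hNy (Arow A *m xs)).
  by case: (h y1) => [a||]//; case: (h (Arow A *m xs)) => [b||]//; exists b.
(* First-order optimality of [xs] along the segment to [x]: [h] is bounded by convexity, [fsum f] by
   its quadratic upper bound. *)
have slope x s : h (Arow A *m x) = s%:E ->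
    0 <= s - r + dotp (grad (fsum f) xs) (x - xs).
  move=> hs; have [c fle] := fsum_le xs (x - xs).
  apply: (@ge0_of_small_slope _ _ c) => N; set t : R := N.+2%:R^-1.
  have t0 : 0 < t by rewrite invr_gt0 ltr0n.
  have t1 : t < 1 by rewrite invf_lt1 ?ltr1n ?ltr0n.
  have t01 : 0 < t < 1 by rewrite t0.
  have := hcvx (Arow A *m x) (Arow A *m xs) t t01.
  rewrite !scalemxAr -mulmxDr hs hr.
  have -> : t *: x + (1 - t) *: xs = xs + t *: (x - xs).
    by apply/matrixP => i j; rewrite !mxE; ring.
  have := xsP (xs + t *: (x - xs)); rewrite !objE hr.
  move: (hNy (Arow A *m (xs + t *: (x - xs)))).
  case: (h _) => [b|//|//] _; rewrite !lee_fin => H1 H2.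
  rewrite -(pmulr_rge0 _ t0); have := fle t; move: H1 H2; lra.
have [u gu] : exists u, grad (fsum f) xs = (Arow A)^T *m u.
  apply: row_space_of_orth_kernel => w Aw.
  have := slope (xs + w) r; rewrite mulmxDr Aw addr0 hr => /(_ erefl).
  have := slope (xs - w) r; rewrite mulmxBr Aw subr0 hr => /(_ erefl).
  by rewrite ![xs + _]addrC !addrK dotpNr; lra.
exists (- u), r; split => //; first by rewrite mulmxN opprK.
move=> y; have [x <-] := Arow_onto y.
case hs : (h (Arow A *m x)) => [s||]; last 2 first.
- by rewrite leey.
- by have := hNy (Arow A *m x); rewrite hs.
have := slope x s hs; rewrite gu lee_fin -mulmxBr dotpNl (dotp_trmx (Arow A)).
lra.
Qed.

(** If both forms vanish at [v], the C part makes all blocks equal to one vector; the A part says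
    that every A_j^T annihilates it, so full row rank makes it 0. *)
Lemma dual_gram_pd (C : 'M[R]_n) (c : R) : 0 < c -> C^T = C -> psdmx C ->
  null_space C = span_ones ->
  pdmx (Adiag A *m (Adiag A)^T + c *: kronI C).
Proof.
move=> c0 symC C0 C1 v v0.
have kC0 := kronI_psd (p := p) C0.
have vE : dotp v ((Adiag A *m (Adiag A)^T + c *: kronI C) *m v) =
    sqnorm ((Adiag A)^T *m v) + c * dotp v (kronI C *m v).
  by rewrite mulmxDl dotpDr -scalemxAl dotpZr -{1}[Adiag A]trmxK dotp_gram.
have cC : 0 <= c * dotp v (kronI C *m v) by rewrite mulr_ge0 ?kC0// ltW.
rewrite vE lt_neqAle addr_ge0 ?sqnorm_ge0// andbT eq_sym.
apply: contraNN v0 => /eqP E0.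
have Av : (Adiag A)^T *m v = 0.
  by apply: sqnorm_le0; have := sqnorm_ge0 ((Adiag A)^T *m v); lra.
have Cv : kronI C *m v = 0.
  apply: sqnorm_le0.
  have [c1 _ Cc] :=
    quadratic_form_bounded (kronI C : 'M[R]_(\sum_(i < n) p)).
  have symkC : (kronI C)^T = kronI C :> 'M[R]_(\sum_(i < n) p).
    by rewrite kronI_tr symC.
  have := psd_sqnorm_le v symkC kC0 (fun w => le_trans (ler_norm _) (Cc w)).
  have -> : dotp v (kronI C *m v) = 0.
    apply/eqP; rewrite eq_le kC0 andbT -(pmulr_rle0 _ c0).
    by have := sqnorm_ge0 ((Adiag A)^T *m v); lra.
  by rewrite mulr0.
apply/eqP/mxcolP => i; rewrite submxcol0; apply: Arow_free_eq0.
apply/mxcolP => j; rewrite submxcol0 submxcol_trArow.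
rewrite (kronI_null_consensus C1 Cv i j) -submxcol_trAdiag Av.
by rewrite submxcol0.
Qed.

End KKT.


(** * Fixed point of the iteration and linear rate *)

Theorem theorem2 (R : realType) (n p : nat) (d : 'I_n -> nat)
    (e : rel 'I_n)
    (f : forall i, 'cV[R]_(d i) -> R) (g : forall i, 'cV[R]_(d i) -> \bar R)
    (h : 'cV[R]_p -> \bar R) (A : forall i, 'M[R]_(p, d i))
    (B C D : 'M[R]_n) (mu l : 'I_n -> R)
    (alpha beta gamma theta : R)
    (n_gt1 : (1 < n)%N) (p_gt0 : (0 < p)%N)
    (solvable : argmin (objective f g h A) !=set0)
    (saddle : exists xs lams, saddle_point (lagrangian f g h A) xs lams)
    (network : connected_undirected e)
    (mu_gt0 : forall i, 0 < mu i) (mu_le_l : forall i, mu i <= l i)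
    (f_sc : forall i, strongly_convex (mu i) (f i))
    (f_smooth : forall i, smooth (l i) (f i))
    (g_pcl : forall i, proper_convex_lsc (g i)) (h_pcl : proper_convex_lsc h)
    (B_sym : B^T = B) (C_sym : C^T = C) (D_sym : D^T = D)
    (C_null : C = 0 \/ null_space C = span_ones)
    (B_null : null_space B = span_ones)
    (C_ge0 : loewner_le 0 C) (C_lt1 : loewner_lt C 1%:M)
    (B2_le1 : loewner_le (B *m B) 1%:M)
    (D_ds : doubly_stochastic D)
    (g_eq0 : forall i x, g i x = 0%E) (A_full : row_free (Arow A))
    (C_null1 : null_space C = span_ones)
    (D2_le : loewner_le (D *m D) (1%:M - B *m B))
    (theta_ge0 : 0 <= theta)
    (alpha_gt0 : 0 < alpha) (beta_gt0 : 0 < beta) (gamma_gt0 : 0 < gamma)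
    (alpha_lt : alpha < 1 / (fmax l * (1 + 2 * theta)))
    (beta_le : beta <= fmin mu /
       (sv_max (Adiag A) ^+ 2 * (1 / (1 - sv_max C) + theta)))
    (gamma_lt1 : gamma < 1) :
  let E := Adiag A *m (Adiag A)^T + (1 / (2 * alpha * beta)) *: kronI C in
  let delta :=
    Num.max
      (Num.max
        (1 - alpha * fmin mu * (1 - alpha * fmax l * (1 + 2 * theta)))
        (1 - alpha * beta * eig_min_nz E))
      (1 - gamma * sv_min_nz B ^+ 2) in
  0 < delta < 1 /\
  forall (xs : 'cV[R]_(\sum_(i < n) d i))
      (x : nat -> 'cV[R]_(\sum_(i < n) d i))
      (y lam : nat -> 'cV[R]_(\sum_(i < n) p)),
    argmin (objective f g h A) xs ->
    y 0%N = 0 ->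
    npga f g h A B C D alpha beta gamma theta x y lam ->
    (fun k => sqnorm (x k - xs)) =O_\oo (fun k => delta ^+ k).
Proof.
have n0 : (0 < n)%N by apply: ltnW.
have np0 : (0 < \sum_(i < n) p)%N.
  by rewrite sum_nat_const card_ord muln_gt0 n0.
have [[imu fmuE] fmu_le] := fminP mu n0; have [[il flE] fl_ge] := fmaxP l n0.
have fmu0 : 0 < fmin mu by rewrite fmuE.
have fmul : fmin mu <= fmax l.
  by rewrite fmuE (le_trans (mu_le_l imu)).
have fl0 := lt_le_trans fmu0 fmul.
have th1 : 0 < 1 + 2 * theta by rewrite ltr_pwDl// mulr_ge0.
have C0 : psdmx C by move=> w; have := C_ge0 w; rewrite subr0.
have [s01 _ Cs] := psd_sv_max n0 C_sym C0 C_lt1.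
have [b0 Bb] := sv_min_nz_range n_gt1 B_sym B_null.
have aL : alpha * fmax l * (1 + 2 * theta) < 1.
  by move: alpha_lt; rewrite ltr_pdivlMr ?mulr_gt0// mulrA.
have am1 : alpha * fmin mu < 1.
  apply: le_lt_trans aL; rewrite -mulrA ler_pM2l//.
  by apply: le_trans fmul _; rewrite ler_peMr ?(ltW fl0)// lerDl mulr_ge0.
have beta_le' : beta * (sv_max (Adiag A) ^+ 2 * ((1 - sv_max C)^-1 + theta))
    <= fmin mu.
  move: beta_le; rewrite div1r; set D0 := _ * (_ + theta) => Hb.
  (* Division by zero yields 0, so [0 < beta] already excludes a vanishing denominator. *)
  have D00 : 0 < D0.
    have := lt_le_trans beta_gt0 Hb.
    by rewrite pmulr_rgt0// invr_gt0.
  by rewrite -ler_pdivlMr.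
set c := 1 / (2 * alpha * beta).
have c0 : 0 < c by rewrite divr_gt0// !mulr_gt0.
move=> E delta.
have symE : E^T = E.
  by rewrite linearD /= linearZ /= trmx_mul trmxK kronI_tr C_sym.
have Epd : pdmx E by exact: dual_gram_pd.
have [eta0 Eeta] := eig_min_nz_pd np0 symE Epd.
have d1 : 1 - alpha * fmin mu * (1 - alpha * fmax l * (1 + 2 * theta)) <= delta.
  by rewrite !le_max lexx.
have d2 : 1 - alpha * beta * eig_min_nz E <= delta by rewrite !le_max lexx orbT.
have d3 : 1 - gamma * sv_min_nz B ^+ 2 <= delta by rewrite !le_max lexx orbT.
have amu0 : 0 < alpha * fmin mu by rewrite mulr_gt0.
have delta0 : 0 < delta.
  apply: lt_le_trans d1; rewrite subr_gt0; apply: le_lt_trans am1.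
  rewrite ler_piMr ?(ltW amu0)// gerBl mulr_ge0 ?(ltW th1)// mulr_ge0//.
    exact: ltW.
  exact: ltW.
have delta1 : delta < 1.
  rewrite !gt_max !gtrBl !mulr_gt0 ?exprn_gt0 ?subr_gt0//.
split; first by rewrite delta0.
move=> xs x y lam xsP y0 iter.
have f_cvx i : strongly_convex 0 (f i).
  by apply: strongly_convexW (f_sc i); exact: ltW.
have [h_prop h_cvx _] := h_pcl.
have [ls [r [gradE hr sub]]] :=
  kkt_multiplier f_cvx f_smooth A_full g_eq0 h_prop h_cvx xsP.
set y1 := Arow A *m xs in hr sub.
have [hls hsub] := havg_subgradient n0 hr sub.
set La := stack ls in hls hsub; set Y := stack (n%:R^-1 *: y1) in hsub.
have n0R : n%:R != 0 :> R by rewrite pnatr_eq0 -lt0n.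
(* The equation for the y-component of a fixed point. It is solvable because the blocks of
   [Adiag A *m xs] and of [Y] both sum to [y1]. *)
have [w0 zw0] : exists w, beta *: (Adiag A *m xs - Y) = kronI B *m w.
  apply: kronI_range => //.
  under eq_bigr do rewrite submxcolZ submxcolB submxcol_Adiag submxcol_stack.
  rewrite -scaler_sumr big_split /= sumrN sumr_const card_ord -Arow_mul.
  by rewrite -scaler_nat scalerA divff// scale1r subrr scaler0.
(* Removing the mean does not change the image under B but puts [ys] in the range of B, where y^0 =
   0 also lies. *)
pose m0 := n%:R^-1 *: \sum_i submxcol w0 i.
have [w1 zw1] : exists w, w0 - stack m0 = kronI B *m w.
  apply: kronI_range => //.
  under eq_bigr do rewrite submxcolB submxcol_stack.
  rewrite big_split /= sumrN sumr_const card_ord.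
  by rewrite -scaler_nat scalerA divff// scale1r subrr.
set ys := w0 - stack m0 in zw1.
have Bys : kronI B *m ys = beta *: (Adiag A *m xs - Y).
  by rewrite mulmxBr -zw0 kronI_stack_null// subr0.
clearbody ys.
pose v k := lam k - kronI C *m lam k - kronI B *m y k
  + beta *: (Adiag A *m (x k.+1 + theta *: (x k.+1 - x k))).
pose ex k := x k - xs; pose ey k := y k - ys; pose el k := lam k - La.
pose G k := grad (fsum f) (x k) - grad (fsum f) xs.
have opt : grad (fsum f) xs + (Adiag A)^T *m La = 0.
  apply/mxcolP => i; rewrite submxcolD submxcol_trAdiag submxcol_stack gradE.
  by rewrite submxcolN submxcol_trArow addNr submxcol0.
have exS k : ex k.+1 = ex k - alpha *: (G k + (Adiag A)^T *m el k).
  have gsum0 u : gsum g u = 0%E by rewrite /gsum big1.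
  have [/(prox0 alpha_gt0 gsum0) xS _ _] := iter k.
  have -> : G k + (Adiag A)^T *m el k =
      grad (fsum f) (x k) + (Adiag A)^T *m lam k.
    by rewrite /G /el mulmxBr addrACA -opprD opt subr0.
  by rewrite /ex xS addrAC.
(* At the fixed point, v equals [La + beta *: Y]. This is a consensus vector, so B annihilates it
   and D fixes it. *)
have vE k : v k - (La + beta *: Y) = el k - kronI C *m el k - kronI B *m ey k
    + beta *: (Adiag A *m (ex k.+1 + theta *: (ex k.+1 - ex k))).
  have CLa : kronI C *m La = 0 by rewrite kronI_stack_null.
  have -> : ex k.+1 - ex k = x k.+1 - x k by rewrite /ex opprB addrA subrK.
  rewrite /ex /el /ey !mulmxBr CLa subr0 Bys [x k.+1 - xs + _]addrAC.
  rewrite [in RHS]mulmxBr [in RHS]scalerBr scalerBr /v.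
  set a := lam k; set b := kronI C *m _; set e1 := kronI B *m _.
  set e2 := beta *: _.
  set e3 := beta *: Y; set e4 := beta *: _.
  by apply/matrixP => i j; rewrite !mxE; ring.
have BE w : kronI B *m w = kronI B *m (w - (La + beta *: Y)).
  by rewrite mulmxBr mulmxDr -scalemxAr !kronI_stack_null// scaler0 addr0 subr0.
have DE w : kronI D *m w - (La + beta *: Y) = kronI D *m (w - (La + beta *: Y)).
  by rewrite mulmxBr mulmxDr -scalemxAr !kronI_stack_stochastic.
have eyS k : ey k.+1 = ey k + gamma *: (kronI B *m (v k - (La + beta *: Y))).
  by have [_ yS _] := iter k; rewrite -BE /ey yS addrAC.
(* [La] is the prox of [La + beta *: Y], as [Y] is a subgradient of [havg h] there; then D^2 <= I -
   B^2 is applied in each slice. *)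
have elS k : sqnorm (el k.+1) <= sqnorm (v k - (La + beta *: Y))
    - sqnorm (kronI B *m (v k - (La + beta *: Y))).
  have [_ _] := iter k; rewrite -/(v k) => prx.
  have := prox_nonexpansive beta_gt0 (@havg_convex _ _ _ h n0)
    hls hsub prx.
  rewrite DE => H; apply: le_trans H _; rewrite !sqnorm_component -sumrB.
  apply: ler_sum => q _; rewrite !component_kronI; set u := component q _.
  have := D2_le u; rewrite !mulmxBl mul1mx !dotp_lin.
  rewrite -{1}B_sym -{1}D_sym !dotp_gram /sqnorm; lra.
have ey_range k : exists w, ey k = kronI B *m w.
  elim: k => [|k [w eyk]].
    by exists (- w1); rewrite /ey y0 sub0r zw1 mulmxN.
  by rewrite eyS eyk scalemxAr -mulmxDr; eexists.
have ey_le k : sv_min_nz B ^+ 2 * sqnorm (ey k) <= sqnorm (kronI B *m ey k).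
  have [w ->] := ey_range k; rewrite !sqnorm_component mulr_sumr.
  by apply: ler_sum => q _; rewrite !component_kronI.
have C_le k : sqnorm (kronI C *m el k) <= sv_max C * dotp (el k) (kronI C *m el k).
  rewrite sqnorm_component dotp_component mulr_sumr.
  by apply: ler_sum => q _; rewrite !component_kronI.
have E_le k : eig_min_nz E * sqnorm (el k) <= sqnorm ((Adiag A)^T *m el k)
    + (2 * alpha * beta)^-1 * dotp (el k) (kronI C *m el k).
  apply: le_trans (Eeta _) _; rewrite mulmxDl dotpDr -scalemxAl dotpZr.
  by rewrite -{1}[Adiag A]trmxK dotp_gram /c div1r.
have mono k : fmin mu * sqnorm (ex k) <= dotp (ex k) (G k).
  rewrite sqnorm_blocks dotp_blocks mulr_sumr; apply: ler_sum => i _.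
  rewrite !submxcolB !submxcol_grad_fsum.
  by apply: strongly_convex_monotone;
    [exact: (f_smooth i).1..|apply: strongly_convexW (f_sc i)].
have coco k : sqnorm (G k) <= fmax l * dotp (ex k) (G k).
  rewrite sqnorm_blocks dotp_blocks mulr_sumr; apply: ler_sum => i _.
  rewrite !submxcolB !submxcol_grad_fsum.
  have li0 : 0 < l i := lt_le_trans (mu_gt0 i) (mu_le_l i).
  apply: le_trans (smooth_cocoercive _ _ li0 (f_cvx i) (f_smooth i)) _.
  rewrite ler_wpM2r//; apply: le_trans (strongly_convex_monotone _ _ (f_cvx i)).
  - by rewrite mul0r.
  - exact: (f_smooth i).1.
  - exact: (f_smooth i).1.
have kB_sym : (kronI B)^T = kronI B :> 'M[R]_(\sum_(i < n) p).
  by rewrite kronI_tr B_sym.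
pose V k := lyapunov (Adiag A) alpha beta gamma theta (sv_max C)
  (ex k) (ey k) (el k).
have VS k : V k.+1 <= delta * V k.
  rewrite /V eyS vE; apply: (lyapunov_contraction (C := kronI C)
    (a2 := sv_max (Adiag A) ^+ 2) (mu := fmin mu) (l := fmax l)
    (eta := eig_min_nz E) (b2 := sv_min_nz B ^+ 2) (G := G k)) => //.
  - by rewrite fmu0.
  - by rewrite gamma_gt0.
  - exact: sqr_ge0.
  - exact: sv_max_le.
  - by rewrite -vE.
have Vk k : V k <= delta ^+ k * V 0%N.
  elim: k => [|k IH]; first by rewrite expr0 mul1r.
  apply: le_trans (VS k) _; rewrite exprS -mulrA ler_pM2l//.
have kap0 : 0 <= (1 - sv_max C)^-1 + theta.
  by rewrite addr_ge0// invr_ge0 subr_ge0; case/andP: s01 => _ /ltW.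
have Vge k : beta * (alpha^-1 - fmin mu) * sqnorm (ex k) <= V k.
  by apply: lyapunov_ge beta_le' => //; exact: sv_max_le.
set c1 := beta * (alpha^-1 - fmin mu) in Vge.
have c10 : 0 < c1.
  by rewrite mulr_gt0// subr_gt0 -div1r ltr_pdivlMr// mulrC.
(* The summand 1 makes the constant positive even when [V 0%N] is 0. *)
apply/eqO_exP; exists (V 0%N / c1 + 1) => [|].
  rewrite ltr_wpDl// divr_ge0 ?(ltW c10)//.
  by apply: le_trans (Vge 0%N); rewrite mulr_ge0 ?(ltW c10) ?sqnorm_ge0.
near=> k.
rewrite ger0_norm ?sqnorm_ge0// ger0_norm ?exprn_ge0 ?(ltW delta0)//.
have H : sqnorm (ex k) <= V 0%N / c1 * delta ^+ k.
  rewrite mulrAC ler_pdivlMr// mulrC; apply: le_trans (Vge k) _.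
  by rewrite mulrC.
apply: le_trans H _; by rewrite [leRHS]mulrDl mul1r lerDl exprn_ge0// ltW.
Unshelve. all: by end_near. Qed.
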